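(* Let $C: f=0$ be a nodal curve of degree $N$ in $\mathbb{P}^2$. Let $r$ be the number of irreducible components of $C$ and let $f_j=0$, $j=1,\dots,r$, be reduced equations for these components, with $f=f_1\cdots f_r$. Then $H^2(K^*(f))_q=0$ for any $q<N$, $H^2(K^*(f))_N$ is $(r-1)$-dimensional, and a basis for it is given by (the classes of) $$\gamma_j=-f_1\cdots\hat f_j\cdots\hat f_r\, df_j\wedge df_r+h_j\sigma,\qquad j=1,\dots,r-1,$$ where the hats mean that the factors $f_j$ and $f_r$ are omitted, $\sigma=\Delta(dx\wedge dy\wedge dz)$, $h_1=0$ if $r=2$, and $$h_j=\frac{1}{N}\sum_{k\ne j,\ k\ne r}\frac{f}{f_kf_jf_r}\,Jac(f_k,f_j,f_r)$$ if $r>2$.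
   Context: We work over $\mathbb{C}$. Let $S=\mathbb{C}[x,y,z]$ with its standard grading. A nodal curve is a reduced plane curve (possibly reducible) all of whose singularities are nodes (ordinary double points $A_1$). Let $\Omega^p$ be the graded $S$-module of polynomial differential $p$-forms on $\mathbb{C}^3$, graded by $\deg(h\,dx_{i_1}\wedge\dots\wedge dx_{i_q})=p+q$ for $h\in S_p$ homogeneous of degree $p$ (where $x_{i}$ denote the coordinates). The Koszul complex $K^*(f)$ of the partial derivatives of $f$ is $0\to\Omega^0\to\Omega^1\to\Omega^2\to\Omega^3\to 0$ with differential the wedge product by $df$ (homogeneous of degree $N$), and $H^2(K^*(f))_q$ denotes the degree $q$ part of the cohomology at $\Omega^2$ (classes of forms in $\Omega^2_q$). $\Delta:\Omega^{p+1}\to\Omega^p$ is the $S$-linear contraction with the Euler field $x\partial_x+y\partial_y+z\partial_z$, so $\sigma=x\,dy\wedge dz-y\,dx\wedge dz+z\,dx\wedge dy$. $Jac(f_k,f_j,f_r)$ is the Jacobian determinant of $f_k,f_j,f_r$ with respect to $x,y,z$, i.e. $df_k\wedge df_j\wedge df_r=Jac(f_k,f_j,f_r)\,dx\wedge dy\wedge dz$. *)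

(* Defs.v *)
From HB Require Import structures.
From mathcomp Require Import all_boot all_order all_algebra.
From mathcomp Require Import ring_quotient.
From mathcomp Require Import boolp reals complex.
From mathcomp.multinomials Require Import mpoly.

Set Implicit Arguments.
Unset Strict Implicit.
Unset Printing Implicit Defensive.

Import GRing.Theory.
Import Quotient.
Local Open Scope quotient_scope.
Local Open Scope ring_scope.

(* The full exterior algebra of polynomial forms on K^3: the value of a form at
   A = {a < b < ...} is its coefficient on dx_a /\ dx_b /\ ...  The three
   coordinates x, y, z are indexed by 0, 1, 2. *)
Notation polyform K := {ffun {set 'I_3} -> {mpoly K[3]}}.

Section Forms.
Variable K : fieldType.

Local Notation S := {mpoly K[3]}.
Local Notation form := (polyform K).

Definition fscale (h : S) (w : form) : form := [ffun A => h * w A].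

(* The number of inversions when the elements of D are listed after those of
   B: dx_B /\ dx_D = (-1)^(inversions B D) dx_(B u D) for disjoint B and D. *)
Definition inversions (B D : {set 'I_3}) : nat :=
  #|[set p : 'I_3 * 'I_3 | [&& p.1 \in B, p.2 \in D & (p.2 < p.1)%N]]|.

Definition wedge (u v : form) : form :=
  [ffun A : {set 'I_3} => \sum_(B in powerset A)
     (-1) ^+ inversions B (A :\: B) * u B * v (A :\: B)].

Definition dX (i : 'I_3) : form := [ffun A => (A == [set i])%:R].

Definition dform (h : S) : form := \sum_i fscale h^`M(i) (dX i).

(* Contraction with the Euler vector field. *)
Definition contraction (w : form) : form :=
  [ffun A : {set 'I_3} => \sum_(i | i \notin A)
     (-1) ^+ inversions [set i] A * 'X_i * w (i |: A)].

Definition vol : form := wedge (dX 0) (wedge (dX 1) (dX 2)).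

Definition sigma : form := contraction vol.

Definition Jac (f g h : S) : S :=
  \det (\matrix_(a < 3, b < 3) (tnth [tuple f; g; h] a)^`M(b)).

(* Omega^p_q; the degree q is an integer, so that Omega^p_q = 0 for q < p. *)
Definition Omega (p : nat) (q : int) (w : form) : Prop :=
  forall A m, m \in msupp (w A) -> #|A| = p /\ (p + mdeg m)%:Z = q.

Lemma wedge_linear (u : form) : linear (wedge u).
Proof.
move=> a v w; apply/ffunP => A; rewrite !ffunE scaler_sumr -big_split /=.
by apply: eq_bigr => B _; rewrite !ffunE mulrDr scalerAr.
Qed.

Section Koszul.
Variable f : S.

Definition koszul_diff (w : form) : form := wedge (dform f) w.
HB.instance Definition _ :=
  GRing.isLinear.Build K form form _ koszul_diff (wedge_linear (dform f)).

Definition coboundary : pred form :=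
  fun w => `[< exists eta, w = koszul_diff eta >].

Lemma coboundary_zmod : zmod_closed coboundary.
Proof.
split=> [|u v]; first by apply/asboolP; exists 0; rewrite linear0.
move=> /asboolP[a ->] /asboolP[b ->]; apply/asboolP.
by exists (a - b); rewrite linearB.
Qed.
HB.instance Definition _ :=
  GRing.isZmodClosed.Build form coboundary coboundary_zmod.

Lemma coboundaryZ a w : w \in coboundary -> a *: w \in coboundary.
Proof. by move=> /asboolP[b ->]; apply/asboolP; exists (a *: b); rewrite linearZ. Qed.

(* All forms, in all degrees, modulo the image of the Koszul differential; the
   cohomology is the subspace of classes of cocycles. The differential maps
   p-forms to (p+1)-forms, so a p-form is in the image if and only if it is the
   differential of a (p-1)-form. *)
Definition koszul_quot : Type := {quot (GRing.ZmodClosed.clone form coboundary _)}.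
HB.instance Definition _ := GRing.Zmodule.on koszul_quot.
HB.instance Definition _ := ZmodQuotient.on koszul_quot.

Definition koszul_class (w : form) : koszul_quot := \pi_koszul_quot w.

Definition koszul_scale (a : K) (c : koszul_quot) : koszul_quot :=
  koszul_class (a *: repr c).

Lemma koszul_scaleE a w : koszul_scale a (koszul_class w) = koszul_class (a *: w).
Proof.
apply/eqP; rewrite -idealrBE -scalerBr; apply: coboundaryZ.
by rewrite idealrBE reprK.
Qed.

Lemma koszul_classD u v : koszul_class (u + v) = koszul_class u + koszul_class v.
Proof. exact: (raddfD \pi_koszul_quot). Qed.

Lemma koszul_class_ind (P : koszul_quot -> Prop) :
  (forall w, P (koszul_class w)) -> forall c, P c.
Proof. by move=> Pw c; rewrite -[c]reprK; apply: Pw. Qed.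

Lemma koszul_class_eq0 w :
  koszul_class w = 0 <-> exists eta, w = koszul_diff eta.
Proof.
have <- : koszul_class 0 = 0 by exact: (raddf0 \pi_koszul_quot).
split=> [/eqP|w_im]; first by rewrite -idealrBE subr0 => /asboolP.
by apply/eqP; rewrite -idealrBE subr0; apply/asboolP.
Qed.

Fact koszul_scalerA a b c :
  koszul_scale a (koszul_scale b c) = koszul_scale (a * b) c.
Proof. by elim/koszul_class_ind: c => w; rewrite !koszul_scaleE scalerA. Qed.
Fact koszul_scale1r : left_id 1 koszul_scale.
Proof. by elim/koszul_class_ind => w; rewrite koszul_scaleE scale1r. Qed.
Fact koszul_scalerDr : right_distributive koszul_scale +%R.
Proof.
move=> a; elim/koszul_class_ind => u; elim/koszul_class_ind => v.
by rewrite -koszul_classD !koszul_scaleE scalerDr koszul_classD.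
Qed.
Fact koszul_scalerDl c : {morph koszul_scale^~ c : a b / a + b}.
Proof.
by elim/koszul_class_ind: c => w a b; rewrite !koszul_scaleE scalerDl koszul_classD.
Qed.
HB.instance Definition _ := GRing.Zmodule_isLmodule.Build K koszul_quot
  koszul_scalerA koszul_scale1r koszul_scalerDr koszul_scalerDl.

(* H^p(K^*(f))_q *)
Definition koszul_H (p : nat) (q : int) (c : koszul_quot) : Prop :=
  exists w, [/\ Omega p q w, koszul_diff w = 0 & c = koszul_class w].

End Koszul.

Section Basis.
Variable V : lmodType K.

Definition is_basis (U : V -> Prop) (I : finType) (b : I -> V) : Prop :=
  [/\ forall i, U (b i),
      forall c : I -> K, \sum_i c i *: b i = 0 -> forall i, c i = 0
    & forall v, U v -> exists c : I -> K, v = \sum_i c i *: b i].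

Definition has_dim (U : V -> Prop) (n : nat) : Prop :=
  exists b : 'I_n -> V, is_basis U b.

End Basis.

Definition irreducible (p : S) : Prop :=
  [/\ p != 0, p \isn't a GRing.unit
    & forall a b, p = a * b -> a \is a GRing.unit \/ b \is a GRing.unit].

Definition squarefree (p : S) : Prop :=
  forall a b, p = a ^+ 2 * b -> a \is a GRing.unit.

Definition singular_at (f : S) (P : 'I_3 -> K) : Prop :=
  f.@[P] = 0 /\ forall i, f^`M(i).@[P] = 0.

(* Equation of f = 0 in the affine chart x_i = 1, in the coordinates
   x_j - P_j (j <> i) centered at the point P, which must satisfy P_i = 1. *)
Definition local_equation (f : S) (i : 'I_3) (P : 'I_3 -> K) : S :=
  f \mPo [tuple (if j == i then 1 else 'X_j + (P j)%:MP) | j < 3].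

(* The quadratic part of the local equation at the singular point P is a product
   of two distinct lines: ordinary double point. *)
Definition node_at (f : S) (i : 'I_3) (P : 'I_3 -> K) : Prop :=
  exists l1 l2 : S,
    [/\ l1 \is 1.-homog, l2 \is 1.-homog,
        forall a b : K, a *: l1 + b *: l2 = 0 -> a = 0 /\ b = 0
      & pihomog mdeg 2 (local_equation f i P) = l1 * l2].

Definition nodal_curve (N : nat) (f : S) : Prop :=
  [/\ (0 < N)%N, f != 0, f \is N.-homog, squarefree f
    & forall i P, P i = 1 -> singular_at f P -> node_at f i P].

Section Gamma.
Variables (r : nat) (fs : 'I_r -> S).

(* The quotient f / (f_k f_j f_l) is the product of the other factors. The sum
   is empty, hence h_j = 0, if r = 2. *)
Definition hcoef (N : nat) (l j : 'I_r) : S :=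
  N%:R^-1 *: \sum_(k | (k != j) && (k != l))
    (\prod_(i | i \notin [:: k; j; l]) fs i) * Jac (fs k) (fs j) (fs l).

Definition gamma (N : nat) (l j : 'I_r) : form :=
  - fscale (\prod_(i | i \notin [:: j; l]) fs i)
      (wedge (dform (fs j)) (dform (fs l)))
  + fscale (hcoef N l j) sigma.

End Gamma.

End Forms.

(* Main.v *)
From HB Require Import structures.
From mathcomp Require Import all_boot all_order all_algebra.
From mathcomp Require Import boolp reals complex ring lra.
From mathcomp Require classical_sets.
From mathcomp.multinomials Require Import mpoly.
Require Import Defs.

Set Implicit Arguments.
Unset Strict Implicit.
Unset Printing Implicit Defensive.

Import Order.TTheory GRing.Theory Num.Theory.
Local Open Scope ring_scope.

(** Write a 2-form as a vector a of three polynomials, its coefficients on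
dy dz, - dx dz and dx dy, and let X = (x, y, z) be the Euler field. The form is
a cocycle exactly when grad f . a = 0, and the coboundaries have coefficients in
the ideal of the partial derivatives of f, which are homogeneous of degree
N - 1. Hence for q <= N the space H^2_q consists of the Jacobian syzygies a of
degree q - 2, and no quotient is left.

Contraction with X sends a to beta = a x X. Since grad f x beta = N f a
([syzygy_cross]), beta determines a, and f divides all the minors of
(grad f, beta): beta / f is a 1-form with logarithmic poles along the curve.
On the component f_j = 0 the ratio of beta to df is a rational function, the
residue of beta / f. The heart of the proof is that for q = N this residue is
a constant c_j ([residue_constant]). Granting this, beta and the form
sum_j c_j (f / f_j) df_j agree modulo each f_j, hence modulo f, and their
coefficients have degree N - 1 < N, so that they are equal ([beta_logform]).
Contracting once more with X gives sum_j c_j d_j = 0, where d_j is the degree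
of f_j. The contraction of gamma_j is d_r (f / f_j) df_j - d_j (f / f_r) df_r
([gamma_contraction]), and these residue vectors form a basis of the hyperplane
sum_j c_j d_j = 0, which proves the theorem in degree N ([gamma_basis]).

Geometrically the residue is constant because it is regular on the
normalization of a component that meets the others, and itself, only in nodes.
The algebraic form of this argument works with the Jacobian ideal J of f.
At a node P the Hessian of f annihilates both P and a(P), and its rank is two,
so that a(P) is parallel to P and beta vanishes at P ([syzygy_parallel]); the
same rank condition says that J is locally the whole ideal of P
([node_local]). At the other points J is locally the unit ideal. So the
polynomials s such that all s beta_k are in J form a homogeneous ideal without
zeros in the plane, and by the Nullstellensatz it contains every form of some
degree D ([conductor_irrelevant]). Multiplication by the residue therefore maps
the forms of degree N - 1 + D in J, taken modulo f_j, to themselves. That space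
is finite-dimensional and f_j is prime, so the residue is a root of a
polynomial with constant coefficients ([constant_ratio]).

For q < N one multiplies a by coordinates until q = N - 1. Then every x_u a is
a syzygy of degree N - 2; if c_j(u) denotes its residues, f_j divides
c_j(u) x_v - c_j(v) x_u for all u and v, which is impossible unless all c_j(u)
vanish ([low_degree_syzygy]).

The ingredients from algebra are that irreducible polynomials are prime
([mpoly_irreducibles_prime]) and the Nullstellensatz over an uncountable
algebraically closed field ([nullstellensatz]). *)

(** * Irreducible polynomials are prime *)

Section Divides.
Variable A : idomainType.
Implicit Types p q a b c d : A.

Definition divides p a := exists q, a = q * p.

Lemma divides_refl p : divides p p.
Proof. by exists 1; rewrite mul1r. Qed.

Lemma divides0 p : divides p 0.
Proof. by exists 0; rewrite mul0r. Qed.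

Lemma divides_mull c p a : divides p a -> divides p (c * a).
Proof. by case=> q ->; exists (c * q); rewrite mulrA. Qed.

Lemma divides_mulr c p a : divides p a -> divides p (a * c).
Proof. by rewrite mulrC; apply: divides_mull. Qed.

Lemma divides_trans p q a : divides p q -> divides q a -> divides p a.
Proof. by move=> pq [r ->]; apply: divides_mull. Qed.

Lemma dividesD p a b : divides p a -> divides p b -> divides p (a + b).
Proof. by case=> q -> [r ->]; exists (q + r); rewrite mulrDl. Qed.

Lemma dividesN p a : divides p a -> divides p (- a).
Proof. by case=> q ->; exists (- q); rewrite mulNr. Qed.

Lemma dividesB p a b : divides p a -> divides p b -> divides p (a - b).
Proof. by move=> pa pb; apply: dividesD => //; apply: dividesN. Qed.

Lemma divides_sum p (I : Type) (s : seq I) (P : pred I) (F : I -> A) :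
  (forall i, P i -> divides p (F i)) -> divides p (\sum_(i <- s | P i) F i).
Proof.
move=> pF; elim/big_ind: _ => //; first exact: divides0.
by move=> x y; apply: dividesD.
Qed.

Definition irreducible_elt p :=
  [/\ p != 0, p \isn't a GRing.unit
    & forall a b, p = a * b -> a \is a GRing.unit \/ b \is a GRing.unit].

Definition prime_elt p :=
  forall a b, divides p (a * b) -> divides p a \/ divides p b.

Definition irreducibles_prime := forall p, irreducible_elt p -> prime_elt p.

(** Such a size makes the splitting off of nonunit factors terminate. *)
Definition factor_size (mu : A -> nat) :=
  forall a b, a * b != 0 -> b \isn't a GRing.unit -> (mu a < mu (a * b)%R)%N.

Lemma factor_size_ind mu (P : A -> Prop) : factor_size mu ->
    (forall u, u \is a GRing.unit -> P u) ->
    (forall a p, irreducible_elt p -> a != 0 -> P a -> P (a * p)) ->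
  forall a, a != 0 -> P a.
Proof.
move=> muP Pu Pp.
have irr_factor a : a != 0 -> a \isn't a GRing.unit ->
    exists2 p, irreducible_elt p & divides p a.
  have [n] := ubnP (mu a); elim: n a => // n IHn a le_a a0 aNu.
  have [a_irr | a_red] := pselect (irreducible_elt a).
    by exists a => //; apply: divides_refl.
  have [b [c [def_a bNu cNu]]] : exists b c,
      [/\ a = b * c, b \isn't a GRing.unit & c \isn't a GRing.unit].
    apply: contra_notP a_red => no_bc; split=> // b c def_a.
    have [|/negP bNu] := boolP (b \is a GRing.unit); first by left.
    have [|/negP cNu] := boolP (c \is a GRing.unit); first by right.
    by case: no_bc; exists b, c; split=> //; apply/negP.
  have b0 : b != 0 by apply: contraNneq a0 => b0; rewrite def_a b0 mul0r.
  have [|p p_irr pb] := IHn b _ b0 bNu.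
    by apply: leq_trans (_ : mu a <= n)%N; rewrite // def_a muP // -def_a.
  by exists p => //; rewrite def_a; apply: divides_mulr.
move=> a; have [n] := ubnP (mu a); elim: n a => // n IHn a le_a a0.
have [/Pu // | aNu] := boolP (a \is a GRing.unit).
have [p p_irr [b def_a]] := irr_factor a a0 aNu.
have b0 : b != 0 by apply: contraNneq a0 => b0; rewrite def_a b0 mul0r.
rewrite def_a; apply: Pp => //; apply: IHn => //.
apply: leq_trans (_ : mu a <= n)%N => //.
by rewrite def_a muP // -?def_a //; case: p_irr.
Qed.

End Divides.

Section Gauss.
Variables (A : idomainType) (mu : A -> nat).
Hypotheses (muP : factor_size mu) (A_prime : irreducibles_prime A).
Implicit Types (p q w a b : {poly A}) (c d : A).

(** Gauss's lemma: c divides the product of the leading coefficients of a and b,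
hence one of them, and the corresponding leading term can be removed. *)
Lemma polyC_prime c : prime_elt c -> prime_elt c%:P.
Proof.
move=> c_pr a b; have [n] := ubnP (size a + size b).
elim: n a b => // n IHn a b le_n [q abq].
have [-> | a0] := eqVneq a 0; first by left; apply: divides0.
have [-> | b0] := eqVneq b 0; first by right; apply: divides0.
have : divides c (lead_coef a * lead_coef b).
  by rewrite -lead_coefM abq lead_coefM lead_coefC; exists (lead_coef q).
have step (g h : {poly A}) : g != 0 -> (size g + size h <= n)%N ->
    divides c (lead_coef g) -> divides c%:P (g * h) ->
    divides c%:P g \/ divides c%:P h.
  move=> g0 le_gh [r lg] [s gh]; pose g' := g - lead_coef g *: 'X^((size g).-1).
  have cg : divides c%:P (lead_coef g *: 'X^((size g).-1)).
    by exists (r *: 'X^((size g).-1)); rewrite lg -!mul_polyC polyCM; ring.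
  have lt_g' : (size g' < size g)%N.
    rewrite -[X in (_ < X)%N]prednK ?size_poly_gt0 // ltnS.
    apply/leq_sizeP => j; rewrite leq_eqVlt => /predU1P[<- | lt_j].
      by rewrite coefB coefZ coefXn eqxx mulr1 subrr.
    rewrite coefB coefZ coefXn gtn_eqF // mulr0 subr0 nth_default //.
    by rewrite -ltnS prednK ?size_poly_gt0 // in lt_j *.
  have [|||] := IHn g' h; last 2 first.
  - by move=> cg'; left; rewrite -(subrK (lead_coef g *: 'X^((size g).-1)) g);
      apply: dividesD.
  - by right.
  - by apply: leq_trans le_gh; rewrite ltn_add2r.
  rewrite mulrBl; apply: dividesB; first by exists s.
  exact: divides_mulr.
have ab_le : (size a + size b <= n)%N by [].
case/c_pr => [ca | cb]; first by apply: step => //; exists q.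
have [||cb' | ca] := step b a b0 _ cb; [| |by right|by left].
  by rewrite addnC.
by exists q; rewrite mulrC.
Qed.

Definition primitive p := forall c, irreducible_elt c -> ~ divides c%:P p.

(** The irreducible factors of d are cancelled one at a time: as constant
polynomials they are prime and do not divide p. *)
Lemma primitive_cancel p a d :
  primitive p -> d != 0 -> divides p (d *: a) -> divides p a.
Proof.
move=> p_prim d0; move: d d0 a; apply: (factor_size_ind muP) => [u uU|d c c_irr _ IHd] a.
  case=> q uaq; exists (u^-1 *: q).
  by rewrite -scalerAl -uaq scalerA mulVr // scale1r.
rewrite mulrC -scalerA => -[q caq].
have [] := polyC_prime (A_prime c_irr) (a := q) (b := p); last 1 first.
- by move/(p_prim _ c_irr).
- by exists (d *: a); rewrite -caq mulrC mul_polyC.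
case=> r qr; apply: IHd; exists r.
have c0 : c%:P != 0 by rewrite polyC_eq0; case: c_irr.
by apply: (mulfI c0); rewrite mul_polyC caq qr; ring.
Qed.

(** Each irreducible factor of d divides q or w and is removed from it. This
turns a factorization of p over the fraction field into one over A. *)
Lemma divides_primitive_part p q w d :
  d != 0 -> d *: p = q * w -> w != 0 ->
  exists q' w' e, [/\ p = q' * w', e != 0 & w = e *: w'].
Proof.
move=> d0; move: d d0 q w.
apply: (factor_size_ind muP) => [u uU|d c c_irr d0 IHd] q w dpqw w0.
  exists (u^-1 *: q), w, 1; split; rewrite ?oner_eq0 ?scale1r //.
  by rewrite -scalerAl -dpqw scalerA mulVr // scale1r.
have c0 : c%:P != 0 by rewrite polyC_eq0; case: c_irr.
have [] := polyC_prime (A_prime c_irr) (a := q) (b := w).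
- by exists (d *: p); rewrite -dpqw [RHS]mulrC mul_polyC scalerA mulrC.
- case=> r qr; apply: (IHd r w) => //; apply: (mulfI c0).
  by rewrite mul_polyC scalerA [c * d]mulrC dpqw qr; ring.
case=> r wr; have r0 : r != 0 by apply: contraNneq w0 => r0; rewrite wr r0 mul0r.
have [|q' [w' [e [pqw e0 rw]]]] := IHd q r _ r0.
  by apply: (mulfI c0); rewrite mul_polyC scalerA [c * d]mulrC dpqw wr; ring.
exists q', w', (e * c); split=> //; first by rewrite mulf_neq0 //; case: c_irr.
by rewrite wr rw [LHS]mulrC mul_polyC scalerA mulrC.
Qed.

(** Pseudo-division takes the place of division over the fraction field. Let p
divide a b, and let w be a nonzero element of least degree of the ideal (a, p).
Then w divides constant multiples of a and of p. As p is irreducible, w is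
either p up to constants, and p divides a, or a constant, and p divides b. *)
Lemma poly_irreducibles_prime : irreducibles_prime {poly A}.
Proof.
move=> p p_irr; have [p0 pNu p_fact] := p_irr.
have [p_le1 | p_gt1] := leqP (size p) 1.
  have def_p := size1_polyC p_le1; rewrite def_p; apply: polyC_prime.
  apply: A_prime; split=> [||a b def_c].
  - by rewrite -polyC_eq0 -def_p.
  - apply: contra pNu => cU; rewrite poly_unitE cU andbT eqn_leq p_le1.
    by rewrite size_poly_gt0.
  - have := p_fact a%:P b%:P; rewrite -polyCM -def_c -def_p => /(_ erefl).
    by rewrite !poly_unitE !coefC /= => -[] /andP[_ ?]; [left | right].
have p_prim : primitive p.
  move=> c [c0 cNu _] [q pqc]; have [] := p_fact _ _ pqc.
    rewrite poly_unitE => /andP[/eqP q1 _].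
    by move: p_gt1; rewrite pqc mulrC mul_polyC size_scale // q1.
  by rewrite poly_unitE coefC /= (negPf cNu) andbF.
move=> a b pab; have [|pNa] := pselect (divides p a); [by left | right].
pose comb w := exists u v, w = u * a + v * p.
pose P n := `[< exists w, [/\ comb w, w != 0 & size w = n] >].
have exP : exists n, P n.
  exists (size p); apply/asboolP; exists p; split=> //.
  by exists 0, 1; rewrite mul0r mul1r add0r.
case: (ex_minnP exP) => n /asboolP[w [w_comb w0 <-]] w_min {n exP}.
have w_div g : comb g -> exists q d, d != 0 /\ d *: g = q * w.
  case=> u' [v' gE]; case: w_comb => u [v wE].
  have := Pdiv.Idomain.divp_eq g w.
  set d := _ ^+ _; set q := g %/ w; set r := g %% w => gqr.
  have d0 : d != 0 by rewrite expf_neq0 ?lead_coef_eq0.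
  exists q, d; split=> //; suff r0 : r = 0 by rewrite gqr r0 addr0.
  apply/eqP; apply: contraT => r0.
  have := ltn_modpN0 g w0; rewrite ltnNge => /negP[]; apply: w_min.
  apply/asboolP; exists r; split=> //.
  exists (d *: u' - q * u), (d *: v' - q * v).
  have -> : r = d *: g - q * w by rewrite gqr addrC addKr.
  by rewrite [in LHS]wE [in LHS]gE -!mul_polyC; ring.
have [|q [d [d0 dpqw]]] := w_div p; first by exists 0, 1; rewrite mul0r mul1r add0r.
have [|q2 [d2 [d20 daqw]]] := w_div a; first by exists 1, 0; rewrite mul0r mul1r addr0.
have [q' [w' [e [pqw e0 we]]]] := divides_primitive_part d0 dpqw w0.
have [q'U | w'U] := p_fact _ _ pqw.
  case: pNa; apply: (primitive_cancel p_prim d20); rewrite daqw we.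
  exists (q2 * (e *: q'^-1)); rewrite pqw -scalerAr -!scalerAr -!scalerAl.
  by rewrite mulrA -(mulrA q2) mulVr // mulr1.
case: w_comb => u [v wE].
have : divides p (e *: b).
  have -> : e *: b = w'^-1 * (u * (a * b) + b * v * p).
    have -> : u * (a * b) + b * v * p = w * b by rewrite wE; ring.
    by rewrite we -scalerAl -scalerAr mulrA mulVr // mul1r.
  apply: divides_mull; apply: dividesD; apply: divides_mull => //.
  exact: divides_refl.
exact: primitive_cancel.
Qed.

End Gauss.

Section MpolyPrime.
Variable K : fieldType.

Lemma mpoly_nonunit_msize n (p : {mpoly K[n]}) :
  p != 0 -> p \isn't a GRing.unit -> (1 < msize p)%N.
Proof.
move=> p0; apply: contraR; rewrite -leqNgt => p_le1.
have pC := msize1_polyC p_le1; rewrite pC; apply: rmorph_unit.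
by rewrite unitfE -(mpolyC_eq0 n) -pC.
Qed.

Lemma msize_factor_size n : factor_size (fun p : {mpoly K[n]} => msize p).
Proof.
move=> a b; rewrite mulf_eq0 negb_or => /andP[a0 b0] bNu.
rewrite msizeM //; have := mpoly_nonunit_msize b0 bNu.
by case: (msize b) => [|[|k]] // _; rewrite !addnS /= ltnS leq_addr.
Qed.

Lemma iso_irreducibles_prime (A B : idomainType)
    (phi : {rmorphism A -> B}) (psi : {rmorphism B -> A}) :
  cancel phi psi -> cancel psi phi ->
  irreducibles_prime B -> irreducibles_prime A.
Proof.
move=> phiK psiK B_prime p [p0 pNu p_fact] a b [q abq].
have unit_psi c : c \is a GRing.unit -> psi c \is a GRing.unit.
  exact: rmorph_unit.
have unit_phi c : c \is a GRing.unit -> phi c \is a GRing.unit.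
  exact: rmorph_unit.
have [||[r /(congr1 psi)] | [r /(congr1 psi)]] := B_prime (phi p) _ (phi a) (phi b).
- split; first by rewrite -(rmorph0 phi) (can_eq phiK).
    by apply: contra pNu => /unit_psi; rewrite phiK.
  move=> c d /(congr1 psi); rewrite phiK rmorphM => /p_fact.
  by case=> /unit_phi; rewrite psiK; [left | right].
- by exists (phi q); rewrite -!rmorphM abq.
- by rewrite rmorphM !phiK => ->; left; exists (psi r).
by rewrite rmorphM !phiK => ->; right; exists (psi r).
Qed.

Lemma mpoly0_unit (p : {mpoly K[0]}) : p != 0 -> p \is a GRing.unit.
Proof.
rewrite [p]nvar0_mpolyC mpolyC_eq0 => p0.
by apply: rmorph_unit; rewrite unitfE.
Qed.

Lemma muniXm n (m : 'X_{1..n.+1}) :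
  muni 'X_[K, m] =
  'X_[[multinom m (widen_ord (leqnSn n) i) | i < n]] *: 'X^(m ord_max).
Proof. by rewrite muniE msuppX big_seq1 mcoeffX eqxx scale1r. Qed.

Lemma muni_mwiden n (p : {mpoly K[n]}) : muni (mwiden p) = p%:P.
Proof.
elim/mpolyind: p => [|c m p _ _ IHp]; first by rewrite !rmorph0.
rewrite mwidenD muniD polyCD IHp mwidenZ mwidenX muniZ muniXm mnmwiden_ordmax expr0.
rewrite scalerA alg_polyC; congr (_%:P + _).
rewrite mul_mpolyC; congr (_ *: 'X_[_]).
by apply/mnmP => i; rewrite mnmE mnmwiden_widen.
Qed.

(** The inverse of [muni]. *)
Definition poly_mpoly n : {poly {mpoly K[n]}} -> {mpoly K[n.+1]} :=
  horner_eval 'X_ord_max \o map_poly (@mwiden n K).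
HB.instance Definition _ n := GRing.RMorphism.copy (@poly_mpoly n)
  (horner_eval 'X_ord_max \o map_poly (@mwiden n K)).

Lemma muniK n : cancel (@muni n K) (@poly_mpoly n).
Proof.
move=> p; elim/mpolyind: p => [|c m p _ _ IHp]; first by rewrite !rmorph0.
rewrite muniD [LHS](rmorphD (@poly_mpoly n)) [X in _ + X]IHp; congr (_ + _).
rewrite muniZ muniXm scalerA mul_mpolyC -mul_polyC rmorphM rmorphXn /=.
rewrite /poly_mpoly /= /horner_eval map_polyC map_polyX hornerC hornerX /=.
rewrite mwidenZ mwidenX -scalerAl mpolyXn -mpolyXD; congr (_ *: 'X_[_]).
apply/mnmP => i; rewrite mnmDE mulmnE mnm1E.
have [j ->|->] := unliftP ord_max i.
  have -> : lift ord_max j = widen_ord (leqnSn n) j.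
    by apply/val_inj; rewrite [LHS]lift_max.
  rewrite mnmwiden_widen mnmE eqE /= [n == _]gtn_eqF ?ltn_ord // mul0n addn0.
  by [].
by rewrite mnmwiden_ordmax eqxx mul1n.
Qed.

Lemma poly_mpolyK n : cancel (@poly_mpoly n) (@muni n K).
Proof.
elim/poly_ind => [|p c IHp]; first by rewrite !rmorph0.
rewrite !(rmorphD, rmorphM) /= IHp.
rewrite /poly_mpoly /= /horner_eval map_polyC map_polyX hornerC hornerX /=.
rewrite muni_mwiden muniXm mnm1E eqxx expr1; congr (_ * _ + _).
rewrite -[RHS]scale1r; congr (_ *: _); rewrite -mpolyX0; congr 'X_[_].
apply/mnmP => i; rewrite mnmE mnm1E mnm0E eqE /=.
by rewrite [n == _]gtn_eqF.
Qed.

Lemma mpoly_irreducibles_prime n : irreducibles_prime {mpoly K[n]}.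
Proof.
elim: n => [|n IHn]; first by move=> p [/mpoly0_unit pU /negP].
apply: iso_irreducibles_prime (@muniK n) (@poly_mpolyK n) _.
exact: poly_irreducibles_prime (@msize_factor_size n) IHn.
Qed.

End MpolyPrime.

(** * Hilbert's Nullstellensatz *)

Section Ideals.
Import classical_sets.
Variable A : comNzRingType.
Implicit Types (I : A -> Prop) (a b s t : A).

Definition is_ideal I :=
  [/\ I 0, forall a b, I a -> I b -> I (a + b) & forall c a, I a -> I (c * a)].

Section Closure.
Variables (I : A -> Prop) (idI : is_ideal I).

Lemma ideal0 : I 0. Proof. by case: idI. Qed.

Lemma idealD a b : I a -> I b -> I (a + b).
Proof. by case: idI => _ D _; apply: D. Qed.

Lemma idealM c a : I a -> I (c * a).
Proof. by case: idI => _ _ M; apply: M. Qed.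

Lemma idealMr c a : I a -> I (a * c).
Proof. by rewrite mulrC; apply: idealM. Qed.

Lemma idealN a : I a -> I (- a).
Proof. by rewrite -mulN1r; apply: idealM. Qed.

Lemma idealB a b : I a -> I b -> I (a - b).
Proof. by move=> Ia Ib; apply: idealD => //; apply: idealN. Qed.

Lemma ideal_sum (J : Type) (r : seq J) (P : pred J) (F : J -> A) :
  (forall j, P j -> I (F j)) -> I (\sum_(j <- r | P j) F j).
Proof. by move=> IF; elim/big_ind: _ => //; [exact: ideal0 | exact: idealD]. Qed.

Lemma idealBr a b : I b -> I (a - b) -> I a.
Proof. by move=> Ib Iab; rewrite -(subrK b a); apply: idealD. Qed.

End Closure.

Lemma ideal_adjoin I s : is_ideal I ->
  is_ideal (fun a => exists m t, I m /\ a = m + t * s).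
Proof.
move=> idI; split=> [|a b [m [t [Im ->]]] [m' [t' [Im' ->]]]|c a [m [t [Im ->]]]].
- by exists 0, 0; rewrite mul0r addr0; split=> //; apply: ideal0.
- by exists (m + m'), (t + t'); split; [apply: idealD | ring].
by exists (c * m), (c * t); split; [apply: idealM | ring].
Qed.

Lemma maximal_ideal I : is_ideal I -> ~ I 1 ->
  exists M, [/\ is_ideal M, ~ M 1, forall a, I a -> M a
    & forall s, ~ M s -> exists t, M (t * s - 1)].
Proof.
move=> idI I1; pose proper (J : set A) := is_ideal J /\ ~ J 1.
(* Taking the union with I makes the empty chain harmless. *)
have [F F_proper F_chain|B [[idM M1] M_max]] :=
    @Zorn_bigcup A (fun B : set A => proper (B `|` I)%classic).
  have mem_F a : ((\bigcup_(X in F) X) `|` I)%classic a ->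
      I a \/ exists2 X, F X & X a.
    by case=> [[X FX Xa]|]; [right; exists X | left].
  have F_mem X a : F X -> (X `|` I)%classic a ->
      ((\bigcup_(X in F) X) `|` I)%classic a.
    by move=> FX [Xa|Ia]; [left; exists X | right].
  split; last by case/mem_F => // -[X /F_proper[_ X1] ?]; apply: X1; left.
  split=> [|a b|c a].
  - by right; apply: ideal0.
  - case/mem_F => [Ia | [X FX Xa]]; case/mem_F => [Ib | [Y FY Yb]].
    + by right; apply: idealD.
    + have [idY _] := F_proper _ FY.
      by apply: (F_mem Y) => //; apply: idealD idY _ _ _ _; [right | left].
    + have [idX _] := F_proper _ FX.
      by apply: (F_mem X) => //; apply: idealD idX _ _ _ _; [left | right].
    + have [idX _] := F_proper _ FX; have [idY _] := F_proper _ FY.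
      have [XY | YX] := F_chain X Y FX FY.
        by apply: (F_mem Y) => //; apply: idealD idY _ _ _ _; left; [apply: XY|].
      by apply: (F_mem X) => //; apply: idealD idX _ _ _ _; left; [|apply: YX].
  - case/mem_F => [Ia | [X FX Xa]]; first by right; apply: idealM.
    have [idX _] := F_proper _ FX.
    by apply: (F_mem X) => //; apply: idealM idX _ _ _; left.
exists (B `|` I)%classic; split=> // [a Ia | s sNM]; first by right.
pose M' : set A := fun a => exists m t, (B `|` I)%classic m /\ a = m + t * s.
have : M' 1.
  apply: contrapT => M'1.
  have BM' a : (B `|` I)%classic a -> M' a.
    by exists a, 0; rewrite mul0r addr0.
  apply: (M_max M'); last first.
    rewrite /proper (_ : (M' `|` I)%classic = M').
      by split=> //; apply: ideal_adjoin.
    by apply/seteqP; split=> a; [case=> // Ia; apply: BM'; right | left].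
  split=> [a Ba | M'B]; first by apply: BM'; left.
  apply: sNM; left; apply: M'B; exists 0, 1; rewrite mul1r add0r.
  by split=> //; apply: ideal0.
case=> m [t [Mm one]]; exists t.
by rewrite one opprD addrCA subrr addr0; apply: idealN.
Qed.

End Ideals.

Definition alg_closed (K : fieldType) :=
  forall p : {poly K}, size p != 1%N -> exists a, root p a.

(** Stated with finite sets because those that arise below, the a such that
x - a has an inverse of bounded degree, are shown to be finite. *)
Definition uncountable (K : eqType) :=
  forall F : nat -> seq K, exists a, forall k, a \notin F k.

Section Nullstellensatz.
Variables (K : fieldType) (n : nat).
Hypotheses (K_closed : alg_closed K) (K_uncountable : uncountable K).
Local Notation S := {mpoly K[n]}.

(** Polynomials of bounded degree form a finite-dimensional space. *)
Lemma mpoly_dependent D : exists k, forall h : 'I_k -> S,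
  (forall i, msize (h i) <= D)%N ->
  exists2 c : 'I_k -> K, exists i, c i != 0 & \sum_i c i *: h i = 0.
Proof.
pose T : finType := 'X_{1..n < D}; exists #|T|.+1 => h h_le.
pose M := \matrix_(i < #|T|.+1, j < #|T|) (h i)@_(enum_val j : 'X_{1..n}).
have : kermx M != 0.
  by rewrite kermx_eq0 -row_leq_rank -ltnNge ltnS rank_leq_col.
case/rowV0Pn => v /sub_kermxP vM v0; exists (v 0).
  apply: contra_neqP v0 => v0; apply/rowP => i; rewrite mxE.
  by apply: contra_notP v0 => /eqP; exists i.
apply/mpolyP => m; rewrite mcoeff0 raddf_sum /=.
have [lt_mD | le_Dm] := ltnP (mdeg m) D.
  have := congr1 (fun w : 'rV_ _ => w 0 (enum_rank (BMultinom lt_mD : T))) vM.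
  rewrite !mxE => vM0; rewrite -[RHS]vM0; apply: eq_bigr => i _.
  by rewrite mcoeffZ mxE enum_rankK.
apply: big1 => i _; rewrite mcoeffZ.
by rewrite (memN_msupp_eq0 (msize_mdeg_ge (leq_trans (h_le i) le_Dm))) mulr0.
Qed.

Lemma ideal_morph (I : S -> Prop) (psi : {rmorphism S -> S}) :
    is_ideal I -> (forall c, psi c%:MP = c%:MP) ->
    (forall i, I ('X_i - psi 'X_i)) ->
  forall p, I (p - psi p).
Proof.
move=> idI psiC psiX.
have IM p q : I (p - psi p) -> I (q - psi q) -> I (p * q - psi (p * q)).
  move=> Ip Iq; have -> : p * q - psi (p * q) = q * (p - psi p) + psi p * (q - psi q).
    by rewrite rmorphM; ring.
  by apply: idealD => //; apply: idealM.
have I1 : I (1 - psi 1) by rewrite rmorph1 subrr; apply: ideal0.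
elim/mpolyind => [|c m p _ _ Ip]; first by rewrite rmorph0 subrr; apply: ideal0.
rewrite rmorphD opprD addrACA; apply: idealD => //.
rewrite -mul_mpolyC; apply: (IM c%:MP); first by rewrite psiC subrr; apply: ideal0.
rewrite mpolyXE_id; pose Q q := I (q - psi q).
rewrite -/(Q _); apply: (big_ind Q) => // i _; rewrite /Q.
by elim: (m i) => [|k IHk] //; rewrite exprS; apply: (IM 'X_i).
Qed.

Lemma finite_cover (Q : K -> Prop) k :
    (forall s : seq K, uniq s -> (forall a, a \in s -> Q a) -> size s != k) ->
  exists s : seq K, forall a, Q a -> a \in s.
Proof.
elim: k => [|k IHk] Q_lt.
  by suff : size ([::] : seq K) != 0%N by []; apply: Q_lt.
have [[s [s_uniq sQ size_s]] | no_s] := pselect (exists s : seq K,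
  [/\ uniq s, (forall a, a \in s -> Q a) & size s = k]).
  exists s => a Qa; apply: contraT => a_s.
  suff : size (a :: s) != k.+1 by rewrite /= size_s eqxx.
  apply: Q_lt => [|b]; first by rewrite /= a_s.
  by rewrite inE => /predU1P[-> | /sQ].
apply: IHk => s s_uniq sQ; apply/eqP => size_s; case: no_s.
by exists s.
Qed.

Section MaximalPoint.
Variable M : S -> Prop.
Hypotheses (idM : is_ideal M) (M1 : ~ M 1).
Hypothesis M_max : forall s, ~ M s -> exists t, M (t * s - 1).

Lemma maximal_prime a b : M (a * b) -> M a \/ M b.
Proof.
move=> Mab; have [|/M_max[t Mta]] := pselect (M a); [by left | right].
apply: (idealBr idM (b := t * (a * b))); first exact: idealM.
have -> : b - t * (a * b) = - b * (t * a - 1) by ring.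
exact: idealM.
Qed.

Lemma maximal_root (x : S) (q : {poly K}) :
  q != 0 -> M (map_poly (@mpolyC n K) q).[x] -> exists a, M (x - a%:MP).
Proof.
have MC c : M c%:MP -> c = 0.
  move=> Mc; apply/eqP; apply: contra_notT M1 => c0.
  have -> : 1 = c^-1%:MP * c%:MP :> S by rewrite -mpolyCM mulVf.
  exact: idealM.
have [k] := ubnP (size q); elim: k q => // k IHk q le_q q0.
have [/eqP/size_poly1P[c c0 ->] | q1] := eqVneq (size q) 1%N.
  by rewrite map_polyC /= hornerC => /MC/eqP; rewrite (negPf c0).
have [b /factor_theorem[q' def_q]] := K_closed q1.
have q'0 : q' != 0 by apply: contraNneq q0 => q'0; rewrite def_q q'0 mul0r.
rewrite def_q rmorphM hornerM => /maximal_prime[|]; last first.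
  by rewrite rmorphB /= map_polyX map_polyC /= hornerXsubC; exists b.
apply: IHk => //; move: le_q; rewrite def_q size_Mmonic ?monicXsubC //.
by rewrite size_XsubC addn2.
Qed.

(** Otherwise each x - a has an inverse t a modulo M. As K is uncountable,
infinitely many of the t a have the same degree bound, so that they are linearly
dependent. Multiplying a linear relation by the product of the x - a involved
gives a nonzero polynomial in x with constant coefficients that lies in M; it
splits, and M is prime. *)
Lemma maximal_coordinate (x : S) : exists a, M (x - a%:MP).
Proof.
apply: contrapT => no_a.
have [t Mt] : {t : K -> S & forall a, M (t a * (x - a%:MP) - 1)}.
  apply: (choice (P := fun a t => M (t * (x - a%:MP) - 1))) => a.
  by apply: M_max => Ma; apply: no_a; exists a.
have cover D : exists s : seq K, forall a, (msize (t a) <= D)%N -> a \in s.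
  have [k dep] := mpoly_dependent D; apply: (@finite_cover _ k) => s s_uniq s_le.
  apply/eqP => size_s.
  have [|c [i0 ci0] ct0] := dep (fun i => t s`_i).
    by move=> i; apply: s_le; rewrite mem_nth // size_s.
  (* q (x) is the product of all x - s`_j times the sum of the c i / (x - s`_i). *)
  pose q := \sum_(i < k) c i *: \prod_(j < k | j != i) ('X - (s`_j)%:P).
  have q0 : q != 0.
    apply: contraNneq ci0 => q0; have := congr1 (horner^~ s`_i0) q0.
    rewrite /q horner_sum horner0 (bigD1 i0) //= [X in _ + X]big1 ?addr0 => [|i i_i0].
      move/eqP; rewrite hornerZ horner_prod mulf_eq0 => /orP[//|].
      rewrite prodf_seq_eq0 => /hasP[j _ /andP[j_i0]].
      rewrite hornerXsubC subr_eq0 nth_uniq ?size_s //.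
      by rewrite eq_sym (inj_eq val_inj) (negPf j_i0).
    rewrite hornerZ horner_prod (bigD1 i0) 1?eq_sym //=.
    by rewrite hornerXsubC subrr mul0r mulr0.
  apply: no_a; apply: (maximal_root q0).
  pose g i := \prod_(j < k | j != i) (x - (s`_j)%:MP).
  have -> : (map_poly (@mpolyC n K) q).[x] = \sum_(i < k) (c i)%:MP * g i.
    rewrite /q rmorph_sum horner_sum; apply: eq_bigr => i _.
    rewrite -mul_polyC rmorphM /= map_polyC /= hornerM hornerC; congr (_ * _).
    rewrite rmorph_prod horner_prod; apply: eq_bigr => j _.
    by rewrite rmorphB /= map_polyX map_polyC /= hornerXsubC.
  have -> : \sum_(i < k) (c i)%:MP * g i =
      \sum_(i < k) - ((c i)%:MP * g i) * (t s`_i * (x - (s`_i)%:MP) - 1).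
    apply/eqP; rewrite -subr_eq0 -sumrB.
    under eq_bigr => i _.
      have -> : (c i)%:MP * g i - - ((c i)%:MP * g i) * (t s`_i * (x - (s`_i)%:MP) - 1)
        = (c i)%:MP * t s`_i * ((x - (s`_i)%:MP) * g i) by ring.
      have -> : (x - (s`_i)%:MP) * g i = \prod_(j < k) (x - (s`_j)%:MP).
        by rewrite [RHS](bigD1 i).
      rewrite mul_mpolyC.
      over.
    by rewrite -mulr_suml ct0 mul0r.
  by apply: ideal_sum => // i _; apply: idealM.
have [F FP] := choice cover.
have [a aF] := K_uncountable F.
by have := aF (msize (t a)); rewrite FP.
Qed.

End MaximalPoint.

Lemma nullstellensatz (I : S -> Prop) : is_ideal I -> ~ I 1 ->
  exists P : 'I_n -> K, forall s, I s -> s.@[P] = 0.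
Proof.
move=> idI I1; have [M [idM M1 IM M_max]] := maximal_ideal idI I1.
have [P MP] : {P : 'I_n -> K & forall i, M ('X_i - (P i)%:MP)}.
  apply: (choice (P := fun i a => M ('X_i - a%:MP))) => i.
  exact: maximal_coordinate.
exists P => s /IM Ms; apply/eqP; apply: contra_notT M1 => sP0.
pose psi : {rmorphism S -> S} := @mpolyC n K \o meval P.
have Mpsi : M (s - psi s).
  apply: ideal_morph => // [c | i]; first by rewrite /= mevalC.
  by rewrite /= mevalXU.
have -> : 1 = (s.@[P]^-1)%:MP * (s - (s - psi s)).
  by rewrite opprB addrCA subrr addr0 /= -mpolyCM mulVf.
by apply: idealM => //; apply: idealB.
Qed.

End Nullstellensatz.

(** * Homogeneous polynomials and their derivatives *)

Section Homogeneous.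
Variables (K : fieldType) (n : nat).
Local Notation S := {mpoly K[n]}.
Implicit Types (p q g h : S) (d e : nat).

Lemma mcoeff_pihomog d p m :
  (pihomog mdeg d p)@_m = if mdeg m == d then p@_m else 0.
Proof.
have hom_coef j : mdeg m != j -> (pihomog mdeg j p)@_m = 0.
  by apply: dhomog_nemf_coeff; apply: pihomogP.
case: eqP => [<-|/eqP/hom_coef //].
have lt_m : (mdeg m < maxn (msize p) (mdeg m).+1)%N by rewrite leq_maxr.
have := congr1 (mcoeff m)
  (pihomog_partitionE (mf := mdeg) (leq_maxl (msize p) (mdeg m).+1)).
rewrite (raddf_sum (mcoeff m)) (bigD1 (Ordinal lt_m)) //= big1 ?addr0 // => j ne_j.
by apply: hom_coef; rewrite eq_sym; apply: contra ne_j => /eqP e; apply/eqP/val_inj.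
Qed.

Lemma pihomogM d e g h : g \is e.-homog ->
  pihomog mdeg (e + d) (g * h) = g * pihomog mdeg d h.
Proof.
move=> g_hom.
rewrite {1}(pihomog_partitionE (mf := mdeg) (p := h) (k := maxn (msize h) d.+1));
  rewrite ?leq_maxl //.
have lt_d : (d < maxn (msize h) d.+1)%N by rewrite leq_maxr.
rewrite mulr_sumr raddf_sum (bigD1 (Ordinal lt_d)) //= big1 ?addr0 => [|j ne_j].
  by apply: pihomog_dE; apply: dhomogM => //; apply: pihomogP.
apply: (@pihomog_ne0 _ _ _ (e + j)); last by apply: dhomogM => //; apply: pihomogP.
by rewrite eqn_add2l; apply: contra ne_j => /eqP e'; apply/eqP/val_inj.
Qed.

Lemma pihomogM_lt d e g h : g \is e.-homog -> (d < e)%N ->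
  pihomog mdeg d (g * h) = 0.
Proof.
move=> g_hom lt_de.
rewrite {1}(pihomog_partitionE (mf := mdeg) (p := h) (k := msize h)) //.
rewrite mulr_sumr raddf_sum big1 // => j _.
apply: (@pihomog_ne0 _ _ _ (e + j)); last by apply: dhomogM => //; apply: pihomogP.
by rewrite gtn_eqF // (leq_trans lt_de) ?leq_addr.
Qed.

Lemma homog_mul_cancel d e g h : g != 0 -> g \is e.-homog ->
  g * h \is (e + d).-homog -> h \is d.-homog.
Proof.
move=> g0 g_hom gh_hom; rewrite homog_piE; apply/eqP/(mulfI g0).
by rewrite -(pihomogM d h g_hom) pihomog_dE.
Qed.

Lemma homog_divides_lt d e g h :
  g \is e.-homog -> h \is d.-homog -> (d < e)%N -> divides g h -> h = 0.
Proof.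
move=> g_hom h_hom lt_de [q hE].
by rewrite -(pihomog_dE h_hom) hE mulrC (pihomogM_lt _ g_hom).
Qed.

Lemma homogX i : ('X_i : S) \is 1.-homog.
Proof. by rewrite dhomogX; apply/eqP; apply: mdeg1. Qed.

Lemma mpolyXU_neq0 i : ('X_i : S) != 0.
Proof.
apply/eqP => /(congr1 (mcoeff U_(i)))/eqP.
by rewrite mcoeffXU eqxx mcoeff0 oner_eq0.
Qed.

Lemma homogXn i d : ('X_i ^+ d : S) \is d.-homog.
Proof. by rewrite -[d in d.-homog]mul1n; apply: dhomogMn; apply: homogX. Qed.

Lemma mderiv_homog d p i : p \is d.-homog -> p^`M(i) \is d.-1.-homog.
Proof.
move/dhomogP => p_hom; apply/dhomogP => m; rewrite mcoeff_msupp mcoeff_deriv => pm.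
have p_m : (m + U_(i))%MM \in msupp p.
  by rewrite mcoeff_msupp; apply: contraNneq pm => ->; rewrite mul0rn.
by have <- : mdeg (m + U_(i)) = d := p_hom _ p_m; rewrite mdegD mdeg1 addn1.
Qed.

Lemma mderivXU i j : ('X_i : S)^`M(j) = (i == j)%:R.
Proof.
rewrite mderivX mnm1E; have [-> | _] := eqVneq i j; last by rewrite scale0r.
by rewrite scale1r -mpolyX0; congr 'X_[_]; apply/mnmP => k; rewrite mnmBE subnn mnm0E.
Qed.

Lemma euler d p : p \is d.-homog -> \sum_i 'X_i * p^`M(i) = p *+ d.
Proof.
move=> p_hom.
have XdX (m : 'X_{1..n}) i : 'X_i * ('X_[m])^`M(i) = 'X_[K, m] *+ m i.
  rewrite mderivX -scalerAr -mpolyXD scaler_nat.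
  case: (posnP (m i)) => [-> | m_gt0]; first by rewrite !mulr0n.
  congr ('X_[_] *+ _); apply/mnmP => k; rewrite mnmDE mnmBE mnm1E.
  by case: eqP => [<-|_]; rewrite ?subnKC // add0n subn0.
transitivity (\sum_(m <- msupp p) p@_m *: ('X_[m] *+ mdeg m)).
  transitivity (\sum_i \sum_(m <- msupp p) p@_m *: ('X_[m] *+ m i)).
    apply: eq_bigr => i _; rewrite {1}[p]mpolyE raddf_sum mulr_sumr.
    by apply: eq_bigr => m _; rewrite /= mderivZ -scalerAr XdX.
  rewrite exchange_big; apply: eq_bigr => m _.
  by rewrite -scaler_sumr mdegE -sumrMnr.
rewrite [in RHS](mpolyE p) -sumrMnl !big_seq; apply: eq_bigr => m m_p.
by rewrite scalerMnr; move/dhomogP: p_hom => ->.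
Qed.

Lemma meval0_coef p : p.@[fun _ => 0] = p@_0%MM.
Proof.
elim/mpolyind: p => [|c m p _ _ IHp]; first by rewrite meval0 mcoeff0.
rewrite mevalD mcoeffD IHp mevalZ mcoeffZ mevalX mcoeffX; congr (_ * _ + _).
have [-> | m0] := eqVneq m 0%MM; first by rewrite big1 // => i _; rewrite mnm0E expr0.
have [i mi] : exists i, m i != 0%N.
  apply: contra_neqP m0 => no_i; apply/mnmP => i; rewrite mnm0E; apply/eqP.
  by apply: contra_notT no_i; exists i.
by rewrite (bigD1 i) //= expr0n (negPf mi) mul0r.
Qed.

Lemma meval_homog d p (v : 'I_n -> K) i : p \is d.-homog ->
  p \mPo [tuple v k *: 'X_i | k < n] = p.@[v] *: ('X_i ^+ d : S).
Proof.
move/dhomogP => p_hom; rewrite comp_mpolyE mevalE scaler_suml !big_seq.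
apply: eq_bigr => m m_p; rewrite -scalerA; congr (_ *: _).
have <- : mdeg m = d := p_hom m m_p; rewrite mdegE expr_sum -scaler_prod.
by apply: eq_bigr => k _; rewrite tnth_mktuple exprZn.
Qed.

Lemma mderiv_prod_seq (I : eqType) (s : seq I) (F : I -> S) i :
  uniq s -> (\prod_(j <- s) F j)^`M(i) =
  \sum_(j <- s) (\prod_(k <- s | k != j) F k) * (F j)^`M(i).
Proof.
elim: s => [|j s IHs] /=; first by rewrite !big_nil -mpolyC1 mderivC.
case/andP=> js /IHs {}IHs; rewrite !big_cons mderivM IHs eqxx /= mulr_sumr.
congr (_ + _).
  rewrite mulrC; congr (_ * _); rewrite big_seq [RHS]big_seq_cond.
  by apply: eq_bigl => k; case: eqP => [->|]; rewrite ?(negPf js) ?andbT.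
rewrite !big_seq; apply: eq_bigr => k ks; rewrite big_cons mulrA.
by case: eqP => [jk|//]; rewrite jk ks in js.
Qed.

Lemma mderiv_prod (I : finType) (F : I -> S) i :
  (\prod_j F j)^`M(i) = \sum_j (\prod_(k | k != j) F k) * (F j)^`M(i).
Proof.
have := @mderiv_prod_seq _ (index_enum I) F i (index_enum_uniq I); exact.
Qed.

End Homogeneous.

Section ChainRule.
Variables (K : fieldType) (n : nat).
Local Notation S := {mpoly K[n]}.

Lemma mderiv_comp (lq : n.-tuple S) (p : S) u :
  (p \mPo lq)^`M(u) = \sum_k (p^`M(k) \mPo lq) * (tnth lq k)^`M(u).
Proof.
pose Q (p : S) := (p \mPo lq)^`M(u) = \sum_k (p^`M(k) \mPo lq) * (tnth lq k)^`M(u).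
rewrite -/(Q p).
have QC c : Q c%:MP.
  rewrite /Q comp_mpolyC mderivC big1 // => k _.
  by rewrite mderivC comp_mpoly0 mul0r.
have QM g h : Q g -> Q h -> Q (g * h).
  rewrite /Q rmorphM mderivM => -> ->; rewrite mulr_suml mulr_sumr -big_split.
  apply: eq_bigr => k _ /=; rewrite mderivM !(rmorphD, rmorphM) /=; ring.
elim/mpolyind: p => [|c m p _ _ Qp]; first by rewrite -(mpolyC0 n); apply: QC.
have Qm : Q (c *: 'X_[m]).
  rewrite -mul_mpolyC; apply: (QM) => //; rewrite mpolyXE_id.
  apply: (big_ind Q) => [||i _]; [by rewrite -mpolyC1; apply: QC | exact: QM |].
  elim: (m i) => [|k IHk]; first by rewrite expr0 -mpolyC1; apply: QC.
  rewrite exprS; apply: (QM) => //; rewrite /Q comp_mpolyXU -tnth_nth.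
  rewrite (bigD1 i) //= big1 ?addr0 => [|j /negPf ji].
    by rewrite mderivXU eqxx comp_mpoly1 mul1r.
  by rewrite mderivXU eq_sym ji comp_mpoly0 mul0r.
rewrite /Q rmorphD mderivD Qm Qp -big_split; apply: eq_bigr => k _ /=.
by rewrite mderivD rmorphD mulrDl.
Qed.

End ChainRule.

(** * Vectors of polynomials in three variables *)

Lemma ord3P (P : 'I_3 -> Prop) : P 0 -> P 1 -> P 2 -> forall i, P i.
Proof.
move=> P0 P1 P2 [[|[|[|//]]] lt_i].
- by rewrite (_ : Ordinal lt_i = 0) //; apply: val_inj.
- by rewrite (_ : Ordinal lt_i = 1) //; apply: val_inj.
- by rewrite (_ : Ordinal lt_i = 2) //; apply: val_inj.
Qed.

Lemma sum3E (V : nmodType) (F : 'I_3 -> V) : \sum_i F i = F 0 + F 1 + F 2.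
Proof.
rewrite !big_ord_recl big_ord0 addr0 addrA.
by congr (F _ + F _ + F _); apply: val_inj.
Qed.

Section Vectors.
Variable A : comNzRingType.
Implicit Types u v w : 'I_3 -> A.

Definition dot u v := \sum_i u i * v i.
Definition cross u v (k : 'I_3) := u (k + 1) * v (k + 2) - u (k + 2) * v (k + 1).

Lemma dotE u v : dot u v = u 0 * v 0 + u 1 * v 1 + u 2 * v 2.
Proof. exact: sum3E. Qed.

Lemma cross0 u v : cross u v 0 = u 1 * v 2 - u 2 * v 1.
Proof. by rewrite /cross !add0r. Qed.
Lemma cross1 u v : cross u v 1 = u 2 * v 0 - u 0 * v 2.
Proof. by congr (u _ * v _ - u _ * v _); apply: val_inj. Qed.
Lemma cross2 u v : cross u v 2 = u 0 * v 1 - u 1 * v 0.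
Proof. by congr (u _ * v _ - u _ * v _); apply: val_inj. Qed.
Definition crossE := (cross0, cross1, cross2).

Lemma dotC u v : dot u v = dot v u.
Proof. by apply: eq_bigr => i _; rewrite mulrC. Qed.

Lemma double_cross u v w k :
  cross u (cross v w) k = v k * dot u w - w k * dot u v.
Proof. by elim/ord3P: k; rewrite !crossE !dotE; ring. Qed.

Lemma cross_crossl u v w k :
  cross (cross u v) w k = v k * dot u w - u k * dot v w.
Proof. by elim/ord3P: k; rewrite !crossE !dotE; ring. Qed.

End Vectors.

Section Forms2.
Variable K : fieldType.
Implicit Types a b c d s t v w : K.

Lemma independent_forms2 a b c d v w :
    (forall s t, s * a + t * c = 0 -> s * b + t * d = 0 -> s = 0 /\ t = 0) ->
  a * v + b * w = 0 -> c * v + d * w = 0 -> v = 0 /\ w = 0.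
Proof.
move=> ind e1 e2.
have [det0 | det_neq0] := eqVneq (a * d - b * c) 0.
  have [] := ind d (- b); [by rewrite -det0; ring | ring | move=> d0 /eqP].
  rewrite oppr_eq0 => /eqP b0.
  have [] := ind c (- a); [ring | by rewrite b0 d0; ring | move=> c0 /eqP].
  rewrite oppr_eq0 => /eqP a0.
  have [] := ind 1 0; rewrite ?a0 ?b0 ?c0 ?d0 ?mulr0 ?addr0 //.
  by move/eqP; rewrite oner_eq0.
split; apply/eqP; move: det_neq0; apply: contraNT => x0;
  rewrite -(inj_eq (mulIf x0)) mul0r.
  have -> : (a * d - b * c) * v = d * (a * v + b * w) - b * (c * v + d * w) by ring.
  by rewrite e1 e2 !mulr0 subr0.
have -> : (a * d - b * c) * w = a * (c * v + d * w) - c * (a * v + b * w) by ring.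
by rewrite e1 e2 !mulr0 subr0.
Qed.

(** Two independent linear forms in three variables have a line as common
kernel; here it is spanned by the i-th basis vector. *)
Lemma independent_forms_kernel (A B : 'I_3 -> K) i (v : 'I_3 -> K) :
    (forall s t, (forall k, s * A k + t * B k = 0) -> s = 0 /\ t = 0) ->
    A i = 0 -> B i = 0 -> v i = 0 -> dot A v = 0 -> dot B v = 0 ->
  forall k, v k = 0.
Proof.
move=> ind Ai Bi vi; rewrite !dotE.
have ind' j k : (forall l, [|| l == i, l == j | l == k]) -> forall s t,
    s * A j + t * B j = 0 -> s * A k + t * B k = 0 -> s = 0 /\ t = 0.
  move=> ijk s t e1 e2; apply: ind => l.
  by case/or3P: (ijk l) => /eqP->; rewrite // Ai Bi !mulr0 addr0.
elim/ord3P: i Ai Bi vi ind' => -> -> vi ind'; rewrite vi mul0r ?(add0r, addr0) => e1 e2.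
- have [|v1 v2] := independent_forms2 (ind' 1 2 _) e1 e2; first exact: ord3P.
  by apply: ord3P.
- have [|v0 v2] := independent_forms2 (ind' 0 2 _) e1 e2; first exact: ord3P.
  by apply: ord3P.
have [|v0 v1] := independent_forms2 (ind' 0 1 _) e1 e2; first exact: ord3P.
by apply: ord3P.
Qed.

End Forms2.

Section Gradient.
Variable K : fieldType.
Local Notation S := {mpoly K[3]}.

Definition grad (g : S) (k : 'I_3) : S := g^`M(k).
Definition coord (k : 'I_3) : S := 'X_k.

Lemma dot_grad_coord d g : g \is d.-homog -> dot (grad g) coord = g *+ d.
Proof. by move=> g_hom; rewrite dotC [LHS](euler g_hom). Qed.

Lemma hessian_coord d (g : S) u : g \is d.-homog ->
  \sum_w 'X_w * g^`M(u)^`M(w) = g^`M(u) *+ d.-1.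
Proof. by move=> g_hom; apply: euler; apply: mderiv_homog. Qed.

(** In degree two the local equation is l1 * l2, so that its Hessian at the
origin has the common kernel of l1 and l2, a line, as its kernel. This line is
the i-th axis, for x_i does not occur in the local equation. In the directions
other than the i-th one the Hessians of f and of the local equation agree. *)
Lemma node_hessian (f : S) i (P : 'I_3 -> K) (v : 'I_3 -> K) :
    P i = 1 -> node_at f i P -> v i = 0 ->
    (forall u, u != i -> \sum_w f^`M(u)^`M(w).@[P] * v w = 0) ->
  forall k, v k = 0.
Proof.
move=> Pi [l1 [l2 [hom1 hom2 ind quad]]] vi Hv.
set F := local_equation f i P in quad.
pose coef (l : S) k := l^`M(k).@[fun=> 0].
have linE (l : S) : l \is 1.-homog -> l = \sum_k coef l k *: 'X_k.
  move=> hom_l; rewrite -[LHS]mulr1n -(euler hom_l); apply: eq_bigr => k _.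
  have := mderiv_homog k hom_l; rewrite /coef meval0_coef => /dhomog_msize.
  move=> hom0; rewrite -mul_mpolyC mulrC; congr (_ * _).
  apply/mpolyP => m; rewrite mcoeffC.
  have [->|m0] := eqVneq m 0%MM; first by rewrite mulr1.
  rewrite mulr0; apply: (dhomog_nemf_coeff (mderiv_homog k hom_l)).
  by rewrite /= mdeg_eq0.
have indC s t : (forall k, s * coef l1 k + t * coef l2 k = 0) -> s = 0 /\ t = 0.
  move=> st0; apply: ind; rewrite (linE _ hom1) (linE _ hom2) !scaler_sumr -big_split.
  by apply: big1 => k _; rewrite /= !scalerA -scalerDl st0 scale0r.
have lin0 (l : S) : l \is 1.-homog -> l.@[fun=> 0] = 0.
  move=> hom_l; rewrite meval0_coef; apply: (dhomog_nemf_coeff hom_l).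
  by rewrite /= mdeg0.
pose H u w := F^`M(u)^`M(w).@[fun=> 0].
have HE u w : H u w = coef l1 u * coef l2 w + coef l1 w * coef l2 u.
  have -> : H u w = (l1 * l2)^`M(u)^`M(w).@[fun=> 0].
    rewrite /H -quad !meval0_coef !mcoeff_deriv mcoeff_pihomog.
    by rewrite add0m !mdegD !mdeg1.
  rewrite mderivM mderivD !mderivM !(mevalD, mevalM) (lin0 l1 hom1) (lin0 l2 hom2).
  by rewrite mulr0 mul0r add0r addr0.
pose lq : 3.-tuple S := [tuple (if j == i then 1 else 'X_j + (P j)%:MP) | j < 3].
have tup_u k u : (tnth lq k)^`M(u) = ((k == u) && (k != i))%:R :> S.
  rewrite tnth_mktuple; case: eqP => [_|_]; first by rewrite -mpolyC1 mderivC andbF.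
  by rewrite mderivD mderivC addr0 mderivXU andbT.
have dF (g : S) u : (g \mPo lq)^`M(u) = if u == i then 0 else g^`M(u) \mPo lq.
  rewrite mderiv_comp (bigD1 u) //= tup_u eqxx /= big1 ?addr0 => [|k /negPf ku].
    by case: eqP; rewrite ?(mulr1, mulr0).
  by rewrite tup_u ku mulr0.
have Hi u w : (u == i) || (w == i) -> H u w = 0.
  rewrite /H /F /local_equation -/lq dF; case: eqP => [_ _|_ /= wi].
    by rewrite -(mpolyC0 3) mderivC meval0.
  by rewrite dF wi meval0.
have Hf u w : u != i -> w != i -> H u w = f^`M(u)^`M(w).@[P].
  move=> ui wi; rewrite /H /F /local_equation -/lq dF (negPf ui) dF (negPf wi).
  rewrite comp_mpoly_meval; apply: meval_eq => k; rewrite tnth_mktuple.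
  case: eqP => [->|_]; first by rewrite meval1 Pi.
  by rewrite mevalD mevalXU mevalC add0r.
have [A0 B0] : dot (coef l1) v = 0 /\ dot (coef l2) v = 0.
  have [//|B0 A0] := indC (dot (coef l2) v) (dot (coef l1) v); last by split.
  move=> u; transitivity (\sum_w H u w * v w).
    rewrite /dot !mulr_suml -big_split; apply: eq_bigr => w _ /=.
    by rewrite HE; ring.
  have [-> | ui] := eqVneq u i; first by apply: big1 => w _; rewrite Hi ?eqxx ?mul0r.
  rewrite -[RHS](Hv u ui); apply: eq_bigr => w _.
  have [-> | wi] := eqVneq w i; first by rewrite vi !mulr0.
  by rewrite Hf.
have [Bi Ai] : coef l2 i = 0 /\ coef l1 i = 0.
  apply: indC => u; rewrite -(Hi u i) ?eqxx ?orbT // HE; ring.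
exact: (independent_forms_kernel indC Ai Bi vi A0 B0).
Qed.

End Gradient.

(** * The Jacobian ideal of a nodal curve and its multipliers *)

Section Generated.
Variables (A : comNzRingType) (g : 'I_3 -> A).

Definition generated (s : A) := exists t : 'I_3 -> A, s = dot t g.

Lemma generated_ideal : is_ideal generated.
Proof.
split=> [|a b [t ->] [t' ->]|c a [t ->]].
- by exists (fun _ => 0); rewrite dotE !mul0r !addr0.
- by exists (fun k => t k + t' k); rewrite !dotE; ring.
by exists (fun k => c * t k); rewrite !dotE; ring.
Qed.

Lemma generated_gen k : generated (g k).
Proof.
exists (fun i => (i == k)%:R); rewrite /dot (bigD1 k) //= eqxx mul1r.
by rewrite big1 ?addr0 // => i /negPf->; rewrite mul0r.
Qed.

End Generated.

Section Saturation.
Variable K : fieldType.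
Hypotheses (K_closed : alg_closed K) (K_uncountable : uncountable K).
Hypothesis K_char0 : forall n, (n%:R == 0 :> K) = (n == 0%N).
Local Notation S := {mpoly K[3]}.

Variables (N : nat) (f : S).
Hypotheses (N_gt0 : (0 < N)%N) (f_hom : f \is N.-homog).
Hypothesis f_nodes : forall i P, P i = 1 -> singular_at f P -> node_at f i P.

Local Notation jacobian := (generated (grad f)).

Lemma jacobian_pihomog d h : jacobian h -> jacobian (pihomog mdeg d h).
Proof.
case=> t ->; have gr_hom k : grad f k \is N.-1.-homog by apply: mderiv_homog.
rewrite /dot raddf_sum; apply: (ideal_sum (generated_ideal _)) => k _.
rewrite /= mulrC; have [lt_d | le_d] := ltnP d N.-1.
  by rewrite (pihomogM_lt _ (gr_hom k)) //; apply: (ideal0 (generated_ideal _)).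
rewrite -(subnKC le_d) (pihomogM _ _ (gr_hom k)).
apply: (idealMr (generated_ideal _)); exact: generated_gen.
Qed.

(** The coefficients can be replaced by their homogeneous parts of the right
degree. This bound on degrees is what leads to finite-dimensional spaces. *)
Lemma jacobian_homog d h : jacobian h -> h \is (N.-1 + d).-homog ->
  exists2 t : 'I_3 -> S, forall k, t k \is d.-homog & h = dot t (grad f).
Proof.
case=> t hE h_hom; have gr_hom k : grad f k \is N.-1.-homog by apply: mderiv_homog.
exists (fun k => pihomog mdeg d (t k)) => [k|]; first exact: pihomogP.
rewrite -(pihomog_dE h_hom) hE /dot raddf_sum; apply: eq_bigr => k _ /=.
by rewrite mulrC (pihomogM _ _ (gr_hom k)) mulrC.
Qed.

Definition pointform (P : 'I_3 -> K) i k : S := 'X_k - P k *: 'X_i.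

(** Modulo the linear forms through P every x_k becomes P_k x_i, and h becomes
h(P) x_i ^ d. *)
Lemma homog_vanishing (P : 'I_3 -> K) i d h :
  h \is d.-homog -> h.@[P] = 0 -> generated (pointform P i) h.
Proof.
move=> h_hom hP; pose lq := [tuple P k *: ('X_i : S) | k < 3].
suff : generated (pointform P i) (h - (h \mPo lq)).
  by rewrite (meval_homog P i h_hom) hP scale0r subr0.
apply: (ideal_morph (psi := comp_mpoly lq) (generated_ideal _)) => [c|k].
  exact: comp_mpolyC.
rewrite /= comp_mpolyXU -tnth_nth tnth_mktuple; exact: generated_gen.
Qed.

Lemma hessian_kernel P i (v : 'I_3 -> K) :
    P i = 1 -> singular_at f P -> v i = 0 ->
    (forall u, u != i -> \sum_w f^`M(u)^`M(w).@[P] * v w = 0) ->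
  forall k, v k = 0.
Proof. by move=> Pi Psing; apply: node_hessian Pi (f_nodes Pi Psing). Qed.

(** Near a node the Jacobian ideal is the ideal of the node. Indeed, express the
derivatives of f by the linear forms through P. The matrix of coefficients is
the Hessian at P, up to the column i, whose linear form is zero; it becomes
invertible at P when its row i is replaced by a unit vector. By Cramer's rule
its determinant multiplies every linear form through P into J. *)
Lemma node_local P i h d : P i = 1 -> singular_at f P ->
  h \is d.-homog -> h.@[P] = 0 -> exists2 s : S, s.@[P] != 0 & jacobian (s * h).
Proof.
move=> Pi Psing h_hom hP; have [_ gradP] := Psing.
have [M ME] : {M : 'I_3 -> 'I_3 -> S & forall u, grad f u = dot (M u) (pointform P i)}.
  apply: (choice (P := fun u (t : 'I_3 -> S) => grad f u = dot t (pointform P i))).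
  by move=> u; apply: (homog_vanishing _ (mderiv_homog u f_hom)); apply: gradP.
have hessE u w : w != i -> f^`M(u)^`M(w).@[P] = (M u w).@[P].
  move=> wi; rewrite -/(grad f u) ME /dot (raddf_sum (mderiv w)).
  rewrite (raddf_sum (meval P)) /= (bigD1 w) //=.
  have pf0 k : (pointform P i k).@[P] = 0.
    by rewrite mevalB mevalZ !mevalXU Pi mulr1 subrr.
  have pf' k : (pointform P i k)^`M(w) = (k == w)%:R.
    rewrite mderivB mderivZ !mderivXU [i == w]eq_sym (negPf wi).
    by rewrite scaler0 subr0.
  rewrite big1 ?addr0 => [|k /negPf kw].
    by rewrite mderivM pf' eqxx mulr1 mevalD mevalM pf0 mulr0 add0r.
  by rewrite mderivM pf' kw mulr0 addr0 mevalM pf0 mulr0.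
pose B : 'M[S]_3 := \matrix_(u, w) if u == i then (w == i)%:R else M u w.
exists (\det B).
  rewrite -det_map_mx -det_tr; apply/negP => /det0P[v v0].
  move/rowP => vB; case/negP: v0; apply/eqP/rowP => k; rewrite mxE.
  have row_u u : \sum_w (B u w).@[P] * v 0 w = 0.
    have := vB u; rewrite !mxE => vB0; rewrite -[RHS]vB0; apply: eq_bigr => w _.
    by rewrite !mxE mulrC.
  have vi : v 0 i = 0.
    rewrite -[RHS](row_u i) (bigD1 i) //= big1 ?addr0 => [|w /negPf wi].
      by rewrite mxE !eqxx meval1 mul1r.
    by rewrite mxE eqxx wi meval0 mul0r.
  apply: (hessian_kernel Pi Psing vi) => u ui; rewrite -[RHS](row_u u).
  apply: eq_bigr => w _; have [-> | wi] := eqVneq w i; first by rewrite vi !mulr0.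
  by rewrite hessE // mxE (negPf ui).
have [t ->] := homog_vanishing i h_hom hP.
rewrite mulr_sumr; apply: (ideal_sum (generated_ideal _)) => k _.
rewrite mulrCA; apply: (idealM (generated_ideal _)).
pose L : 'cV[S]_3 := \col_w pointform P i w.
have <- : (\adj B *m (B *m L)) k 0 = \det B * pointform P i k.
  by rewrite mulmxA mul_adj_mx mul_scalar_mx !mxE.
rewrite mxE; apply: (ideal_sum (generated_ideal _)) => u _.
apply: (idealM (generated_ideal _)); rewrite mxE.
have [-> | ui] := eqVneq u i.
  rewrite big1 => [|w _]; first exact: (ideal0 (generated_ideal _)).
  rewrite !mxE eqxx; have [-> | _] := eqVneq w i; last by rewrite mul0r.
  by rewrite /pointform Pi scale1r subrr mulr0.
rewrite (_ : \sum_j _ = grad f u); first exact: generated_gen.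
by rewrite ME; apply: eq_bigr => w _; rewrite !mxE (negPf ui).
Qed.

Section Syzygy.
Variables (e : nat) (a : 'I_3 -> S).
Hypotheses (a_hom : forall k, a k \is e.-homog) (a_syz : dot (grad f) a = 0).

Local Notation beta := (cross a (@coord K)).

Lemma cross_coord_homog k : beta k \is e.+1.-homog.
Proof.
by rewrite /cross rpredB // -[e.+1]addn1; apply: dhomogM; rewrite // homogX.
Qed.

(** The Hessian at P annihilates P, by Euler's formula for the derivatives of f,
and a(P), by differentiation of the syzygy. As the kernel of the Hessian is a
line, a(P) is parallel to P. *)
Lemma syzygy_parallel P i k : P i = 1 -> singular_at f P -> (beta k).@[P] = 0.
Proof.
move=> Pi Psing; have [_ gradP] := Psing.
pose v w := (a w).@[P] - (a i).@[P] * P w.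
have v0 : forall w, v w = 0.
  apply: (hessian_kernel Pi Psing) => [|u _]; first by rewrite /v Pi mulr1 subrr.
  have Ha : \sum_w f^`M(u)^`M(w).@[P] * (a w).@[P] = 0.
    have := congr1 (fun g : S => g^`M(u).@[P]) a_syz.
    rewrite /dot (raddf_sum (mderiv u)) (raddf_sum (meval P)) /= mderivC meval0.
    move=> eq0; rewrite -[RHS]eq0.
    apply: eq_bigr => w _; rewrite mderivM mevalD !mevalM gradP mul0r addr0.
    by rewrite mderiv_comm.
  have HP : \sum_w f^`M(u)^`M(w).@[P] * P w = 0.
    have := congr1 (meval P) (hessian_coord u f_hom).
    rewrite (raddf_sum (meval P)) mevalMn gradP mul0rn => eq0; rewrite -[RHS]eq0.
    by apply: eq_bigr => w _ /=; rewrite mevalM mevalXU mulrC.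
  transitivity (\sum_w f^`M(u)^`M(w).@[P] * (a w).@[P]
      - (a i).@[P] * \sum_w f^`M(u)^`M(w).@[P] * P w).
    by rewrite mulr_sumr -sumrB; apply: eq_bigr => w _; rewrite /v; ring.
  by rewrite Ha HP mulr0 subrr.
have [c aP] : exists c, forall w, (a w).@[P] = c * P w.
  by exists (a i).@[P] => w; apply/eqP; rewrite -subr_eq0 -/(v w) v0.
by rewrite mevalB !mevalM !mevalXU !aP; ring.
Qed.

Definition conductor (s : S) := forall k, jacobian (s * beta k).

Lemma conductor_ideal : is_ideal conductor.
Proof.
split=> [k|s t Js Jt k|c s Js k].
- by rewrite mul0r; apply: (ideal0 (generated_ideal _)).
- by rewrite mulrDl; apply: (idealD (generated_ideal _)).
by rewrite -mulrA; apply: (idealM (generated_ideal _)).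
Qed.

Lemma conductor_pihomog d s : conductor s -> conductor (pihomog mdeg d s).
Proof.
move=> Js k; rewrite mulrC -(pihomogM _ _ (cross_coord_homog k)).
by apply: jacobian_pihomog; rewrite mulrC.
Qed.

(** At a singular point the multipliers of the three beta_k given by
[node_local] are multiplied together; at any other point some derivative of f
is a multiplier that does not vanish. *)
Lemma conductor_local P i : P i = 1 -> exists2 s, conductor s & s.@[P] != 0.
Proof.
move=> Pi; have [Psing | Pns] := pselect (singular_at f P); last first.
  have [k fkP] : exists k, (grad f k).@[P] != 0.
    apply: contra_notP Pns => no_k.
    have gradP k : f^`M(k).@[P] = 0.
      by apply/eqP; apply: contra_notT no_k => fk; exists k.
    split=> //; have := congr1 (meval P) (euler f_hom).
    rewrite (raddf_sum (meval P)) big1 => [/esym/eqP|k _]; last first.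
      by rewrite /= mevalM gradP mulr0.
    rewrite mevalMn -mulr_natr mulf_eq0 K_char0 => /orP[/eqP //|].
    by rewrite eqn0Ngt N_gt0.
  exists (grad f k) => // j; apply: (idealMr (generated_ideal _)).
  exact: generated_gen.
have local k : exists s : S, s.@[P] != 0 /\ jacobian (s * beta k).
  have [s sP sJ] :=
    node_local Pi Psing (cross_coord_homog k) (syzygy_parallel k Pi Psing).
  by exists s.
have [s sP] := choice local.
exists (s 0 * s 1 * s 2); last first.
  by rewrite !mevalM !mulf_neq0 //; case: (sP 0) (sP 1) (sP 2) => ? _ [? _] [? _].
move=> k; have dvd : exists r, s 0 * s 1 * s 2 = r * s k.
  elim/ord3P: k; [exists (s 1 * s 2) | exists (s 0 * s 2) | exists (s 0 * s 1)]; ring.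
by case: dvd => r ->; rewrite -mulrA; apply: (idealM (generated_ideal _)); case: (sP k).
Qed.

(** The multipliers have no common zero in the chart x_i = 1, which gives a
relation 1 = m + t (x_i - 1) with m a multiplier. Reading it degree by degree,
the part of t of degree d is - x_i ^ d modulo the multipliers, and it is zero
for large d. *)
Lemma conductor_coord i : exists D, conductor ('X_i ^+ D).
Proof.
have [one | no_one] := pselect
  (exists m t, conductor m /\ 1 = m + t * ('X_i - 1)); last first.
  have [P PP] := nullstellensatz K_closed K_uncountable
    (ideal_adjoin ('X_i - 1) conductor_ideal) no_one.
  have Pi : P i = 1.
    have : ('X_i - 1 : S).@[P] = 0.
      apply: PP; exists 0, 1; rewrite add0r mul1r; split=> //.
      exact: (ideal0 conductor_ideal).
    by move/eqP; rewrite mevalB mevalXU meval1 subr_eq0 => /eqP.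
  have [s sI /eqP[]] := conductor_local Pi.
  by apply: PP; exists s, 0; rewrite mul0r addr0.
case: one => m [t [mI one]].
have tI d : conductor (pihomog mdeg d t + 'X_i ^+ d).
  have one_d := congr1 (pihomog mdeg d) one.
  elim: d one_d => [|d IHd] one_d.
    move: one_d; rewrite mulrBr mulr1 mulrC !raddfD raddfN /=.
    rewrite (pihomogM_lt t (homogX K i)) // add0r expr0.
    rewrite (pihomog_dE (dhomog1 _ _)) => ->.
    rewrite addrCA subrr addr0; exact: conductor_pihomog.
  move: one_d; rewrite mulrBr mulr1 mulrC !raddfD raddfN /=.
  rewrite (pihomog_ne0 (d := 0) _ (dhomog1 _ _)) // -[d.+1]add1n.
  rewrite (pihomogM d t (homogX K i)) addrA => /esym/eqP; rewrite subr_eq0 => /eqP <-.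
  rewrite exprS -addrA -mulrDr; apply: (idealD conductor_ideal).
    exact: conductor_pihomog.
  by apply: (idealM conductor_ideal); apply: IHd; rewrite -one.
exists (msize t).
suff t0 : pihomog mdeg (msize t) t = 0 by have := tI (msize t); rewrite t0 add0r.
apply/mpolyP => m'; rewrite mcoeff_pihomog mcoeff0; case: eqP => // m'_deg.
by apply: memN_msupp_eq0; apply: msize_mdeg_ge; rewrite m'_deg.
Qed.

(** A monomial of degree D_0 + D_1 + D_2 is divisible by some x_i ^ D_i. *)
Lemma conductor_irrelevant : exists D, forall s, s \is D.-homog -> conductor s.
Proof.
have [D DP] := choice conductor_coord; exists (\sum_i D i)%N => s /dhomogP s_hom.
rewrite [s]mpolyE big_seq; apply: (ideal_sum conductor_ideal) => m /s_hom m_deg.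
rewrite -mul_mpolyC; apply: (idealM conductor_ideal).
have [i Di] : exists i, (D i <= m i)%N.
  apply: contrapT => no_i; have : (mdeg m < \sum_i D i)%N; last first.
    by have -> : mdeg m = (\sum_i D i)%N := m_deg; rewrite ltnn.
  have lt_i i : (m i < D i)%N by rewrite ltnNge; apply/negP => ?; apply: no_i; exists i.
  by rewrite mdegE !sum3E -!addSn; rewrite !leq_add // ltnW.
rewrite mpolyXE_id (bigD1 i) //= -(subnK Di) exprD mulrAC.
by apply: (idealM conductor_ideal); apply: DP.
Qed.

End Syzygy.
End Saturation.

(** * Ratios that preserve a finite-dimensional space are constant *)

Section HomogDivisors.
Variables (K : fieldType) (n : nat).
Local Notation S := {mpoly K[n]}.

Lemma homog_msize_le d (p : S) : p \is d.-homog -> (msize p <= d.+1)%N.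
Proof.
move=> /dhomogP p_hom; have [-> | p0] := eqVneq p 0; first by rewrite msize0.
rewrite -mlead_deg //.
by have -> : mdeg (mlead p) = d := p_hom _ (mlead_supp p0).
Qed.

Lemma dividesZ (g h : S) c : divides g h -> divides g (c *: h).
Proof. by rewrite -mul_mpolyC; apply: divides_mull. Qed.

Lemma dividesZ_inv (g h : S) c : c != 0 -> divides g (c *: h) -> divides g h.
Proof. by move=> c0 /(dividesZ c^-1); rewrite scalerA mulVf // scale1r. Qed.

Lemma linear_multiples (g l1 l2 : S) : irreducible_elt g -> l1 != 0 ->
  l1 \is 1.-homog -> l2 \is 1.-homog -> divides g l1 -> divides g l2 ->
  exists c, l2 = c *: l1.
Proof.
case=> g0 gNu _ l10 hom1 hom2 gl1 gl2.
have quot l : l \is 1.-homog -> divides g l -> exists c, l = c *: g.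
  move=> hom_l [q def_l]; have [q0 | q0] := eqVneq q 0.
    by exists 0; rewrite def_l q0 mul0r scale0r.
  have := homog_msize_le hom_l; rewrite def_l msizeM //.
  have := mpoly_nonunit_msize g0 gNu; rewrite (mpolySpred mdeg q0).
  case: (msize g) => [|[|k]] // _.
  rewrite addSn /= !addnS !ltnS leqn0 addn_eq0 => /andP[/eqP q1 _].
  have /msize1_polyC -> : (msize q <= 1)%N by rewrite (mpolySpred mdeg q0) q1.
  by rewrite mul_mpolyC; exists q@_0%MM.
have [c1 e1] := quot _ hom1 gl1; have [c2 e2] := quot _ hom2 gl2.
have c10 : c1 != 0 by apply: contraNneq l10 => c10; rewrite e1 c10 scale0r.
by exists (c2 / c1); rewrite e1 scalerA divfK.
Qed.

End HomogDivisors.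

Section Proportional.
Variable K : fieldType.
Hypothesis K_closed : alg_closed K.
Local Notation S := {mpoly K[3]}.

Variables (g : S) (x y : 'I_3 -> S) (b D : nat) (j : 'I_3).
Hypotheses (g_irr : irreducible_elt g).
Hypotheses (x_hom : forall k, x k \is b.-homog) (y_hom : forall k, y k \is b.-homog).
Hypothesis xy_parallel : forall i k, divides g (y i * x k - y k * x i).
Hypothesis g_yj : ~ divides g (y j).
Hypothesis stable : forall s : 'I_3 -> S, (forall k, s k \is D.-homog) ->
  exists2 t : 'I_3 -> S, forall k, t k \is D.-homog & dot s x = dot t y.

Let g_prime : prime_elt g := mpoly_irreducibles_prime g_irr.

Let comb (h : nat -> S) n (q : {poly K}) := \sum_(k < n) q`_k *: h k.

(** On g = 0 the recurrence says that h k = rho ^ k h 0, where rho = x j / y j,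
and [comb h n q] is q(rho) h 0. The linear factors of q are split off one at a
time. *)
Lemma recurrence_root (h : nat -> S) n (q : {poly K}) :
    (forall k, divides g (y j * h k.+1 - x j * h k)) -> ~ divides g (h 0%N) ->
    q != 0 -> (size q <= n)%N -> divides g (comb h n q) ->
  exists c, divides g (x j - c *: y j).
Proof.
move=> hS h0; elim: n q => [|n IHn] q q0; first by rewrite leqn0 size_poly_eq0 (negPf q0).
have [/eqP/size_poly1P[c c0 ->] _ | q1 le_q gq] := eqVneq (size q) 1%N.
  rewrite /comb big_ord_recl big1 ?addr0 => [|k _].
    by rewrite coefC => /(dividesZ_inv c0).
  by rewrite coefC scale0r.
have [c /factor_theorem[q' def_q]] := K_closed q1.
have q'0 : q' != 0 by apply: contraNneq q0 => q'0; rewrite def_q q'0 mul0r.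
have le_q' : (size q' <= n)%N.
  by move: le_q; rewrite def_q size_Mmonic ?monicXsubC // size_XsubC addn2.
have : divides g ((x j - c *: y j) * comb h n q').
  have -> : (x j - c *: y j) * comb h n q' =
      y j * comb h n.+1 q - \sum_(k < n) q'`_k *: (y j * h k.+1 - x j * h k).
    have -> : comb h n.+1 q = \sum_(k < n) q'`_k *: h k.+1 - c *: comb h n q'.
      rewrite /comb scaler_sumr -sumrB.
      transitivity (\sum_(k < n.+1) ((q' * 'X)`_k *: h k - c *: (q'`_k *: h k))).
        apply: eq_bigr => k _; rewrite def_q mulrBr coefB coefMC scalerBl scalerA.
        by rewrite [q'`_k * c]mulrC.
      rewrite sumrB sumrB big_ord_recl [X in _ - X]big_ord_recr /=.
      rewrite coefMX /= scale0r add0r (nth_default 0 le_q') scale0r scaler0 addr0.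
      by congr (_ - _); apply: eq_bigr => k _; rewrite coefMX.
    have -> : \sum_(k < n) q'`_k *: (y j * h k.+1 - x j * h k) =
        y j * (\sum_(k < n) q'`_k *: h k.+1) - x j * comb h n q'.
      rewrite /comb !mulr_sumr -sumrB; apply: eq_bigr => k _.
      by rewrite scalerBr -!scalerAr.
    by rewrite -!mul_mpolyC; ring.
  apply: dividesB; first exact: divides_mull.
  by apply: divides_sum => k _; apply: dividesZ; apply: hS.
by case/g_prime => [gc | gq']; [exists c | exact: IHn gq'].
Qed.

(** Multiplication by the common ratio rho of the x k to the y k maps the space
of the sums of s k * y k with s homogeneous of degree D to itself modulo g. So
the powers of rho, applied to some element of this space that g does not divide,
are linearly dependent. *)
Lemma constant_ratio : exists c, forall k, divides g (x k - c *: y k).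
Proof.
have ex_next (s : 'I_3 -> S) : exists t : 'I_3 -> S, (forall k, s k \is D.-homog) ->
    (forall k, t k \is D.-homog) /\ dot s x = dot t y.
  have [/stable[t t_hom st] | no_hom] := pselect (forall k, s k \is D.-homog).
    by exists t.
  by exists s.
have [T TP] := choice ex_next.
have [l gXl] : exists l : 'I_3, ~ divides g ('X_l ^+ D).
  apply: contrapT => no_l; have gX (l : 'I_3) : divides g 'X_l.
    have : divides g ('X_l ^+ D).
      by apply: contrapT => gXl; apply: no_l; exists l.
    elim: (D) => [|d IHd].
      rewrite expr0 => -[q one]; case: g_irr => _ /negP[]; apply/unitrP.
      by exists q; rewrite (mulrC g) -one.
    by rewrite exprS => /g_prime[|/IHd].
  have [c] := linear_multiples g_irr (mpolyXU_neq0 K 0)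
    (homogX K 0) (homogX K 1) (gX 0) (gX 1).
  move/(congr1 (mcoeff U_(1)))/eqP; rewrite mcoeffZ !mcoeffXU /= mulr0.
  by rewrite oner_eq0.
pose s0 k : S := if k == j then 'X_l ^+ D else 0.
have s0_hom k : s0 k \is D.-homog.
  by rewrite /s0; case: eqP => _; [apply: homogXn | apply: dhomog0].
pose s k := iter k T s0; have s_hom k : forall i, s k i \is D.-homog.
  by elim: k => [|k IHk] //=; case: (TP _ IHk).
pose h k := dot (s k) y.
have hS k : divides g (y j * h k.+1 - x j * h k).
  have -> : h k.+1 = dot (s k) x by case: (TP _ (s_hom k)).
  rewrite /h /dot !mulr_sumr -sumrB; apply: divides_sum => i _.
  have -> : y j * (s k i * x i) - x j * (s k i * y i) =
    s k i * (y j * x i - y i * x j) by ring.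
  exact: divides_mull.
have h0 : ~ divides g (h 0%N).
  rewrite /h /dot (bigD1 j) //= /s0 eqxx big1 ?addr0 => [|i /negPf->].
    by case/g_prime.
  by rewrite mul0r.
have [n dep] := mpoly_dependent K 3 (D + b).+1.
have [|c [i0 ci0] ch0] := dep (fun k => h k).
  by move=> k; apply: homog_msize_le; apply: rpred_sum => i _; apply: dhomogM.
pose q := \poly_(k < n) (if insub k is Some i then c i else 0).
have qE (i : 'I_n) : q`_i = c i by rewrite coef_poly ltn_ord valK.
have [|||r gr] := @recurrence_root h n q hS h0.
- by apply: contraNneq ci0 => q0; rewrite -qE q0 coef0.
- exact: size_poly.
- rewrite /comb (eq_bigr (fun i : 'I_n => c i *: h i)) => [|i _]; last by rewrite qE.
  by rewrite ch0; apply: divides0.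
exists r => k; have /g_prime[//|//] : divides g (y j * (x k - r *: y k)).
have -> : y j * (x k - r *: y k) = (y j * x k - y k * x j) + y k * (x j - r *: y j).
  by rewrite !mulrBr -!scalerAr [y k * y j]mulrC; ring.
by apply: dividesD => //; apply: divides_mull.
Qed.

End Proportional.

(** * Syzygies and logarithmic forms of a nodal curve *)

Section PrimeProducts.
Variables (A : idomainType) (I : eqType).
Implicit Types (s : seq I) (F : I -> A).

Lemma prime_prod p s F : prime_elt p -> p \isn't a GRing.unit ->
  divides p (\prod_(i <- s) F i) -> exists2 i, i \in s & divides p (F i).
Proof.
move=> p_prime pNu; elim: s => [|i s IHs].
  rewrite big_nil => -[q one]; case/negP: pNu; apply/unitrP.
  by exists q; rewrite (mulrC p) -one.
rewrite big_cons => /p_prime[pi | /IHs[k ks pk]].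
  by exists i; rewrite ?mem_head.
by exists k; rewrite // inE ks orbT.
Qed.

Lemma divides_prod s F h : uniq s ->
    (forall i, i \in s -> prime_elt (F i) /\ F i \isn't a GRing.unit) ->
    (forall i j, i != j -> ~ divides (F i) (F j)) ->
    (forall i, i \in s -> divides (F i) h) ->
  divides (\prod_(i <- s) F i) h.
Proof.
elim: s => [|i s IHs] /=; first by move=> *; rewrite big_nil; exists h; rewrite mulr1.
case/andP=> i_s s_uniq F_prime F_indep Fh.
have [||||q def_h] := IHs => //.
- by move=> j js; apply: F_prime; rewrite inE js orbT.
- by move=> j js; apply: Fh; rewrite inE js orbT.
have [Fi_prime FiNu] := F_prime i (mem_head i s).
have := Fh i (mem_head i s); rewrite def_h => /Fi_prime[[q' ->]|].
  by exists q'; rewrite big_cons mulrA.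
case/(prime_prod Fi_prime FiNu) => j js Fij; case: (F_indep i j) => //.
by apply: contraNneq i_s => ->.
Qed.

End PrimeProducts.

Section Curve.
Variable K : fieldType.
Hypotheses (K_closed : alg_closed K) (K_uncountable : uncountable K).
Hypothesis K_char0 : forall n, (n%:R == 0 :> K) = (n == 0%N).
Local Notation S := {mpoly K[3]}.

Variables (N r : nat) (f : S) (fs : 'I_r -> S) (d : 'I_r -> nat).
Hypotheses (f_nodal : nodal_curve N f) (fs_irr : forall j, irreducible (fs j)).
Hypotheses (fs_hom : forall j, fs j \is (d j).-homog).
Hypothesis f_prod : f = \prod_j fs j.

Let N_gt0 : (0 < N)%N. Proof. by case: f_nodal. Qed.
Let f_neq0 : f != 0. Proof. by case: f_nodal. Qed.
Let f_hom : f \is N.-homog. Proof. by case: f_nodal. Qed.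
Let f_nodes i P : P i = 1 -> singular_at f P -> node_at f i P.
Proof. by case: f_nodal => _ _ _ _; apply. Qed.

(** The quotient f / f_j. *)
Definition others j : S := \prod_(i | i != j) fs i.

Lemma othersE j : f = fs j * others j.
Proof. by rewrite f_prod (bigD1 j). Qed.

Lemma fs_neq0 j : fs j != 0. Proof. by case: (fs_irr j). Qed.
Lemma fs_nonunit j : fs j \isn't a GRing.unit. Proof. by case: (fs_irr j). Qed.
Lemma fs_prime j : prime_elt (fs j).
Proof. exact: mpoly_irreducibles_prime (fs_irr j). Qed.

Lemma fs_degree_gt0 j : (0 < d j)%N.
Proof.
rewrite lt0n; apply/eqP => dj; have := homog_msize_le (fs_hom j).
by rewrite dj leqNgt (mpoly_nonunit_msize (fs_neq0 j) (fs_nonunit j)).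
Qed.

Lemma degree_neq0 j : (d j)%:R != 0 :> K.
Proof. by rewrite K_char0 -lt0n fs_degree_gt0. Qed.

Lemma fs_independent i j : i != j -> ~ divides (fs i) (fs j).
Proof.
move=> ij [q def_j]; have [_ _ /(_ _ _ def_j)[qU | ]] := fs_irr j; last first.
  exact/negP/fs_nonunit.
have [_ _ _ f_sqfree _] := f_nodal; case/negP: (fs_nonunit i).
apply: (f_sqfree _ (q * \prod_(k | (k != i) && (k != j)) fs k)).
rewrite f_prod (bigD1 i) //= (bigD1 j) 1?eq_sym //= def_j.
by rewrite expr2; ring.
Qed.

Lemma fs_others j : ~ divides (fs j) (others j).
Proof.
rewrite /others -big_filter => fj.
have [i ij fji] := prime_prod (@fs_prime j) (fs_nonunit j) fj.
by move: fji; apply: fs_independent; move: ij; rewrite mem_filter eq_sym => /andP[].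
Qed.

(** By Euler's formula, a polynomial of positive degree has a nonzero derivative,
and the degree of that derivative is too small for a multiple. *)
Lemma fs_grad j : exists k, ~ divides (fs j) (grad (fs j) k).
Proof.
apply: contrapT => no_k.
have grad0 k : grad (fs j) k = 0.
  have fjk : divides (fs j) (grad (fs j) k).
    by apply: contrapT => ?; apply: no_k; exists k.
  apply: (homog_divides_lt (fs_hom j) (mderiv_homog k (fs_hom j))) => //.
  by rewrite prednK ?fs_degree_gt0.
have := euler (fs_hom j); rewrite big1 => [|k _]; last by rewrite [_^`M(k)]grad0 mulr0.
move/esym/eqP; rewrite -scaler_nat scaler_eq0 (negPf (fs_neq0 j)) orbF.
by rewrite (negPf (degree_neq0 j)).
Qed.

Lemma gradE k : grad f k = \sum_j others j * grad (fs j) k.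
Proof. by rewrite /grad f_prod mderiv_prod. Qed.

Lemma divides_others i j : i != j -> divides (fs i) (others j).
Proof.
move=> ij; rewrite /others (bigD1 i) //=; apply: divides_mulr.
exact: divides_refl.
Qed.

Lemma sum_others_mod j (F : 'I_r -> S) :
  divides (fs j) (\sum_i others i * F i - others j * F j).
Proof.
rewrite (bigD1 j) //= [X in X - _]addrC addrK; apply: divides_sum => i ij.
by apply: divides_mulr; apply: divides_others; rewrite eq_sym.
Qed.

Lemma fs_gradf j : exists k, ~ divides (fs j) (grad f k).
Proof.
have [k fjk] := fs_grad j; exists k => fj_grad.
have : divides (fs j) (others j * grad (fs j) k).
  have -> : others j * grad (fs j) k =
      grad f k - (\sum_i others i * grad (fs i) k - others j * grad (fs j) k).
    by rewrite -gradE opprB addrCA subrr addr0.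
  by apply: dividesB => //; apply: sum_others_mod.
by case/fs_prime => // /fs_others.
Qed.

Lemma divides_f h : (forall j, divides (fs j) h) -> divides f h.
Proof.
move=> fh; rewrite f_prod; apply: divides_prod => //.
- exact: index_enum_uniq.
- by move=> i _; split; [apply: fs_prime | apply: fs_nonunit].
- by move=> i j; apply: fs_independent.
Qed.

(** The product of f and the logarithmic form with residues c_j, that is, of
f and the sum of the c_j df_j / f_j. *)
Definition logform (c : 'I_r -> K) k : S := \sum_j c j *: (others j * grad (fs j) k).

Lemma logform_mod c j k :
  divides (fs j) (logform c k - c j *: (others j * grad (fs j) k)).
Proof.
have := sum_others_mod j (fun i => c i *: grad (fs i) k).
by under eq_bigr do rewrite -scalerAr; rewrite -scalerAr.
Qed.

Lemma logform_homog c k : logform c k \is N.-1.-homog.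
Proof.
apply: rpred_sum => j _; apply: rpredZ.
apply: (homog_mul_cancel (fs_neq0 j) (fs_hom j)); rewrite mulrA -othersE.
have -> : (d j + N.-1 = N + (d j).-1)%N.
  have := fs_degree_gt0 j; move: N_gt0; case: (N) (d j) => // n [] // m _ _.
  by rewrite /= !addSn addnC.
by apply: dhomogM => //; apply: mderiv_homog.
Qed.

(** Modulo f_j only the term of index j is left, and f_j divides none of its
factors. *)
Lemma logform_inj c : (forall k, logform c k = 0) -> forall j, c j = 0.
Proof.
move=> c0 j; apply/eqP; apply: contra_notT (@fs_others j) => cj0.
have [k fjk] := fs_grad j; have := logform_mod c j k.
rewrite c0 sub0r => /dividesN; rewrite opprK => /(dividesZ_inv cj0).
by case/fs_prime.
Qed.

Lemma dot_logform c : dot (logform c) (@coord K) = (\sum_j c j * (d j)%:R) *: f.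
Proof.
rewrite /dot /logform; under eq_bigr do rewrite mulr_suml.
rewrite exchange_big scaler_suml; apply: eq_bigr => j _ /=.
transitivity (c j *: (others j * dot (grad (fs j)) (@coord K))).
  rewrite /dot mulr_sumr scaler_sumr; apply: eq_bigr => k _.
  by rewrite -scalerAl mulrA.
rewrite (dot_grad_coord (fs_hom j)) -scaler_nat -scalerAr scalerA.
by rewrite mulrC [in RHS](othersE j) [others j * _]mulrC mulrC.
Qed.

Section Syzygy.
Variables (e : nat) (a : 'I_3 -> S).
Hypotheses (a_hom : forall k, a k \is e.-homog) (a_syz : dot (grad f) a = 0).
Local Notation beta := (cross a (@coord K)).

Lemma syzygy_cross k : cross (grad f) beta k = N%:R *: f * a k.
Proof.
rewrite double_cross a_syz mulr0 subr0 (dot_grad_coord f_hom) -scaler_nat.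
by rewrite mulrC.
Qed.

Lemma syzygy_eq0 : (forall k, beta k = 0) -> forall k, a k = 0.
Proof.
move=> beta0 k; apply/eqP; have := syzygy_cross k.
have cross_0 u (v : 'I_3 -> S) : (forall l, v l = 0) -> cross u v k = 0.
  by move=> v0; rewrite /cross !v0 !mulr0 subrr.
rewrite cross_0 // => /esym/eqP.
by rewrite mulf_eq0 scaler_eq0 K_char0 eqn0Ngt N_gt0 (negPf f_neq0) /=.
Qed.

Lemma beta_parallel i k : divides f (grad f i * beta k - grad f k * beta i).
Proof.
have fa j : divides f (cross (grad f) beta j).
  by rewrite syzygy_cross -scalerAl; apply: dividesZ; apply/divides_mulr/divides_refl.
have anti (u v w : S) : divides w (u - v) -> divides w (v - u).
  by move=> /dividesN; rewrite opprB.
have fa0 := fa 0; have fa1 := fa 1; have fa2 := fa 2.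
rewrite cross0 in fa0; rewrite cross1 in fa1; rewrite cross2 in fa2.
elim/ord3P: i; elim/ord3P: k; rewrite ?subrr;
  first [exact: divides0 | by [] | exact: anti].
Qed.

(** The ratio of beta to grad f preserves the Jacobian ideal in high degree. *)
Lemma residue_constant j : e.+2 = N ->
  exists c, forall k, divides (fs j) (beta k - c *: grad f k).
Proof.
move=> eN; have b_hom := cross_coord_homog a_hom.
have [D DP] := conductor_irrelevant K_closed K_uncountable K_char0 N_gt0 f_hom
  f_nodes a_hom a_syz.
have [i fji] := fs_gradf j.
have N1 : N.-1 = e.+1 by rewrite -eN.
apply: (@constant_ratio K K_closed (fs j) beta (grad f) e.+1 D i) => //.
- exact: fs_irr.
- by move=> k; rewrite -N1; apply: mderiv_homog.
- move=> i' k; apply: divides_trans (beta_parallel i' k).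
  by rewrite (othersE j); apply/divides_mulr/divides_refl.
move=> s s_hom; have s_dot : dot s beta \is (N.-1 + D).-homog.
  by rewrite N1 addnC; apply: rpred_sum => k _; apply: dhomogM.
have [|t t_hom st] := jacobian_homog f_hom _ s_dot; last by exists t.
by apply: (ideal_sum (generated_ideal _)) => k _; apply: DP.
Qed.

(** The difference of both sides is divisible by every f_j, and its degree N - 1
is too small for a nonzero multiple of f. *)
Lemma beta_logform : e.+2 = N -> exists c, forall k, beta k = logform c k.
Proof.
move=> eN; have [c cP] := choice (residue_constant^~ eN).
exists c => k; apply/eqP; rewrite -subr_eq0; apply/eqP.
apply: (homog_divides_lt f_hom (d := N.-1)); last 2 first.
- by rewrite prednK.
- apply: divides_f => j.
  have -> : beta k - logform c k = (beta k - c j *: grad f k)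
    + c j *: (\sum_i others i * grad (fs i) k - others j * grad (fs j) k)
    - (logform c k - c j *: (others j * grad (fs j) k)).
    by rewrite -gradE -!mul_mpolyC; ring.
  apply: dividesB; last exact: logform_mod.
  apply: dividesD => //; apply: dividesZ; exact: sum_others_mod.
apply: rpredB; last exact: logform_homog.
by have := cross_coord_homog a_hom k; rewrite -eN.
Qed.

End Syzygy.

Lemma syzygy_scale e a i : (forall k, a k \is e.-homog) -> dot (grad f) a = 0 ->
  (forall k, 'X_i * a k \is e.+1.-homog) /\ dot (grad f) (fun k => 'X_i * a k) = 0.
Proof.
move=> a_hom a_syz; split=> [k|].
  by rewrite -[e.+1]add1n; apply: dhomogM => //; apply: homogX.
rewrite -[RHS](mulr0 'X_i) -a_syz /dot mulr_sumr.
by apply: eq_bigr => k _; rewrite mulrCA.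
Qed.

(** After multiplication by a power of x the degree is N - 3. Then all x_u beta
are logarithmic forms, with residues c u, and eliminating beta shows that f_j
divides the linear forms c_j(u) x_v - c_j(v) x_u. If c_j(u) is not zero, two of
them are linearly independent, which is impossible as f_j is not a unit. *)
Lemma low_degree_syzygy e a : (e.+2 < N)%N ->
  (forall k, a k \is e.-homog) -> dot (grad f) a = 0 -> forall k, a k = 0.
Proof.
move=> lt_eN; have [m def_N] : exists m, (e + m).+3 = N.
  by exists (N - e.+3)%N; rewrite -!addSn subnKC.
elim: m e a {lt_eN} def_N => [|m IHm] e a def_N a_hom a_syz; last first.
  have [Xa_hom Xa_syz] := syzygy_scale 0 a_hom a_syz.
  move=> k; have def_N' : (e.+1 + m).+3 = N by rewrite addSnnS.
  have /eqP := IHm _ _ def_N' Xa_hom Xa_syz k.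
  by rewrite mulf_eq0 (negPf (mpolyXU_neq0 K 0)) => /eqP.
rewrite addn0 in def_N.
have ex_c u : exists c, forall k, 'X_u * cross a (@coord K) k = logform c k.
  have [Xa_hom Xa_syz] := syzygy_scale u a_hom a_syz.
  have [c cP] := beta_logform Xa_hom Xa_syz def_N.
  by exists c => k; rewrite -cP /cross mulrBr !mulrA.
have [c cP] := choice ex_c.
have ratio u v i : divides (fs i) (c u i *: 'X_v - c v i *: 'X_u).
  have [k fik] := fs_grad i; set G := others i * grad (fs i) k.
  suff : divides (fs i) ((c u i *: 'X_v - c v i *: 'X_u) * G).
    by case/fs_prime => // /fs_prime[/fs_others|].
  have -> : (c u i *: 'X_v - c v i *: 'X_u) * G =
      'X_u * (logform (c v) k - c v i *: G) - 'X_v * (logform (c u) k - c u i *: G).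
    by rewrite -!cP -!mul_mpolyC; ring.
  by apply: dividesB; apply: divides_mull; apply: logform_mod.
have c0 u i : c u i = 0.
  apply/eqP; apply: contraT => cui.
  pose v := u + 1; pose w := u + 2.
  have [uv uw vw] : [/\ u != v, u != w & v != w] by elim/ord3P: (u) @v @w.
  have lin_hom t : c u i *: 'X_t - c t i *: 'X_u \is 1.-homog.
    by apply: rpredB; apply: rpredZ; apply: homogX.
  have l0 : c u i *: 'X_v - c v i *: 'X_u != 0 :> S.
    apply: contraNneq cui => /(congr1 (mcoeff U_(v))).
    rewrite mcoeffB !mcoeffZ !mcoeffXU eqxx (negPf uv) mulr0 subr0 mulr1 mcoeff0.
    by move=> ->.
  have [b] := linear_multiples (fs_irr i) l0 (lin_hom v) (lin_hom w)
    (ratio u v i) (ratio u w i).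
  move/(congr1 (mcoeff U_(w)))/eqP.
  rewrite mcoeffB !mcoeffZ mcoeffB !mcoeffZ !mcoeffXU eqxx (negPf uw) (negPf vw).
  by rewrite !mulr0 !subr0 mulr0 mulr1 (negPf cui).
apply: (syzygy_eq0 a_syz) => k; apply/eqP.
have /eqP := cP 0 k; rewrite /logform big1 => [|i _]; last by rewrite c0 scale0r.
by rewrite mulf_eq0 (negPf (mpolyXU_neq0 K 0)).
Qed.

End Curve.

(** * Two-forms as vectors *)

Lemma det_mx22 (A : comNzRingType) (M : 'M[A]_2) :
  \det M = M 0 0 * M 1 1 - M 0 1 * M 1 0.
Proof.
rewrite (expand_det_row _ 0) !big_ord_recl big_ord0 addr0 /cofactor.
rewrite ![\det (row' _ _)](@det_mx11 A) !mxE.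
rewrite expr0 mul1r expr1 mulN1r mulrN.
by congr (M _ _ * M _ _ - M _ _ * M _ _); apply: val_inj.
Qed.

Section TwoForms.
Variable K : fieldType.
Local Notation S := {mpoly K[3]}.
Implicit Types (f g h : S) (u v w : polyform K) (A : {set 'I_3}).

Lemma inversions1 (i : 'I_3) (D : {set 'I_3}) :
  inversions [set i] D = (\sum_(d in D) (d < i))%N.
Proof.
rewrite /inversions.
have -> : [set p : 'I_3 * 'I_3 | [&& p.1 \in [set i], p.2 \in D & (p.2 < p.1)%N]] =
    [set (i, d) | d in [set d in D | (d < i)%N]].
  apply/setP => -[j d]; rewrite !inE /=; apply/and3P/imsetP => [[/eqP-> dD di]|].
    by exists d; rewrite ?inE ?dD.
  by case=> d'; rewrite inE => /andP[dD di] [-> ->]; rewrite eqxx.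
rewrite card_imset => [|d d' []//]; rewrite -sum1_card [LHS]big_mkcond [RHS]big_mkcond.
by apply: eq_bigr => d _; rewrite inE; case: (d \in D); case: (d < i)%N.
Qed.

Lemma dformE g A : dform g A = \sum_i grad g i * (A == [set i])%:R.
Proof. by rewrite /dform sum_ffunE; apply: eq_bigr => i _; rewrite !ffunE. Qed.

Lemma dform1 g i : dform g [set i] = grad g i.
Proof.
rewrite dformE (bigD1 i) //= eqxx mulr1 big1 ?addr0 // => j /negPf ji.
by rewrite (inj_eq set1_inj) eq_sym ji mulr0.
Qed.

Lemma dform_card g A : #|A| != 1%N -> dform g A = 0.
Proof.
move=> A1; rewrite dformE big1 // => i _.
have [Ai | _] := eqVneq A [set i]; first by rewrite Ai cards1 in A1.
by rewrite mulr0.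
Qed.

Lemma wedge_dform g w A :
  wedge (dform g) w A =
  \sum_(i in A) (-1) ^+ inversions [set i] (A :\ i) * grad g i * w (A :\ i).
Proof.
rewrite ffunE.
transitivity (\sum_(B in powerset A) \sum_i
    (-1) ^+ inversions B (A :\: B) * (grad g i * (B == [set i])%:R) * w (A :\: B)).
  by apply: eq_bigr => B _; rewrite dformE mulr_sumr mulr_suml.
rewrite exchange_big /= [RHS]big_mkcond; apply: eq_bigr => i _.
have [iA | iA] := boolP (i \in A).
  rewrite (bigD1 [set i]) /=; last by rewrite powersetE sub1set.
  rewrite eqxx mulr1 big1 ?addr0 //.
  by move=> B /andP[_ /negPf->]; rewrite !mulr0 mul0r.
apply: big1 => B; rewrite powersetE => BA; case: eqP => [Bi | _].
  by rewrite Bi sub1set (negPf iA) in BA.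
by rewrite !mulr0 mul0r.
Qed.

(** Coordinates in the basis dy dz, - dx dz, dx dy, in which the wedge product
of two 1-forms is the cross product and sigma is the Euler field. *)
Definition vec w (k : 'I_3) : S := (-1) ^+ k * w (~: [set k]).

Definition is_2form w := forall A, #|A| != 2 -> w A = 0.

Lemma compl1_remove (k i j : 'I_3) :
  k != i -> k != j -> i != j -> ~: [set k] :\ i = [set j].
Proof.
move=> ki kj ij; apply/setP => x; rewrite !inE.
by elim/ord3P: k ki kj; elim/ord3P: i ij => // ij ki; elim/ord3P: j ij => // ij kj;
  elim/ord3P: x.
Qed.

Lemma sum_compl1 (V : nmodType) (F : 'I_3 -> V) k :
  \sum_(i in ~: [set k]) F i = (if k == 0 then 0 else F 0)
     + (if k == 1 then 0 else F 1) + (if k == 2 then 0 else F 2).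
Proof.
rewrite big_mkcond sum3E !inE ![_ == k]eq_sym.
by case: (k == 0); case: (k == 1); case: (k == 2).
Qed.

Lemma vec_wedge g h k :
  vec (wedge (dform g) (dform h)) k = cross (grad g) (grad h) k.
Proof.
rewrite /vec wedge_dform sum_compl1; elim/ord3P: k => /=.
- rewrite (@compl1_remove 0 1 2) // (@compl1_remove 0 2 1) // !inversions1.
  rewrite !big_set1 !dform1 crossE /=; ring.
- rewrite (@compl1_remove 1 0 2) // (@compl1_remove 1 2 0) // !inversions1.
  rewrite !big_set1 !dform1 crossE /=; ring.
- rewrite (@compl1_remove 2 0 1) // (@compl1_remove 2 1 0) // !inversions1.
  rewrite !big_set1 !dform1 crossE /=; ring.
Qed.

Lemma wedge_2form g h : is_2form (wedge (dform g) (dform h)).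
Proof.
move=> A A2; rewrite wedge_dform big1 // => i iA; rewrite [dform h _]dform_card ?mulr0 //.
by move: A2; rewrite (cardsD1 i A) iA.
Qed.

Lemma dXE i : dX K i = dform 'X_i.
Proof.
apply/ffunP => A; rewrite dformE !ffunE (bigD1 i) //= /grad mderivXU eqxx mul1r.
by rewrite big1 ?addr0 // => j ji; rewrite mderivXU eq_sym (negPf ji) mul0r.
Qed.

Lemma volE A : vol K A = (A == [set: 'I_3])%:R.
Proof.
rewrite /vol !dXE wedge_dform.
have grX i j : grad ('X_i : S) j = (i == j)%:R by apply: mderivXU.
have only (B : {set 'I_3}) i (F : 'I_3 -> S) :
    \sum_(j in B) F j * grad ('X_i : S) j = if i \in B then F i else 0.
  rewrite big_mkcond (bigD1 i) //= grX eqxx mulr1 big1 ?addr0 // => j ji.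
  by rewrite grX eq_sym (negPf ji) mulr0; case: ifP.
under eq_bigr do rewrite mulrAC.
rewrite only; case: ifP => A0; last first.
  by case: eqP => // AT; rewrite AT inE in A0.
rewrite wedge_dform; under eq_bigr do rewrite mulrAC.
rewrite only; case: ifP => A1; last first.
  by rewrite mulr0; case: eqP => // AT; rewrite AT !inE in A1.
have [A2 | A2] := boolP (2 \in A); last first.
  rewrite -dXE ffunE; case: eqP => [/setP/(_ 2) | _].
    by rewrite !inE (negPf A2).
  by rewrite !mulr0; case: eqP => // AT; rewrite AT inE in A2.
have -> : A = setT.
  by apply/setP; apply: ord3P; rewrite inE //; move: A1; rewrite !inE.
have T0 : [set: 'I_3] :\ 0 = ~: [set 0] by rewrite setTD.
rewrite T0 (@compl1_remove 0 1 2) // dform1 grX eqxx !inversions1 big_set1.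
by rewrite sum_compl1 /= eqxx !expr0 !mul1r.
Qed.

Lemma inversions_compl1 k : inversions [set k] (~: [set k]) = k.
Proof. by rewrite inversions1 sum_compl1; elim/ord3P: k. Qed.

Lemma vec_sigma k : vec (sigma K) k = 'X_k.
Proof.
rewrite /vec ffunE (big_pred1 k) => [|i]; last by rewrite /= !inE negbK.
rewrite volE inversions_compl1 setUCr eqxx mulr1 mulrA -expr2.
by rewrite sqrr_sign mul1r.
Qed.

Lemma sigma_2form : is_2form (sigma K).
Proof.
move=> A A2; rewrite ffunE big1 // => i iA; rewrite volE; case: eqP => [AT | _].
  have := cardsU1 i A; rewrite AT cardsT card_ord iA add1n => -[A2'].
  by rewrite -A2' eqxx in A2.
by rewrite mulr0.
Qed.

Lemma card2_compl1 A : #|A| = 2 -> exists k, A = ~: [set k].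
Proof.
move=> A2; have /cards1P[k Ak] : #|~: A| == 1%N.
  by rewrite -(eqn_add2l #|A|) cardsC A2 card_ord.
by exists k; rewrite -Ak setCK.
Qed.

Lemma vec_inj u w : is_2form u -> is_2form w -> vec u =1 vec w -> u = w.
Proof.
move=> u2 w2 uw; apply/ffunP => A; have [|A2] := eqVneq #|A| 2; last by rewrite u2 ?w2.
case/card2_compl1 => k ->; apply: (mulfI (_ : (-1) ^+ k != 0)); last exact: uw.
by rewrite signr_eq0.
Qed.

Lemma koszul_diff2 f w : is_2form w ->
  koszul_diff f w = 0 <-> dot (grad f) (vec w) = 0.
Proof.
move=> w2; have diffT : koszul_diff f w setT = dot (grad f) (vec w).
  rewrite /koszul_diff wedge_dform (eq_bigl xpredT) => [|i]; last by rewrite inE.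
  apply: eq_bigr => k _; rewrite setTD inversions_compl1 /vec; ring.
split=> [w0 | w0]; first by rewrite -diffT w0 ffunE.
apply/ffunP => A; rewrite [RHS]ffunE; have [-> | AT] := eqVneq A setT.
  by rewrite diffT.
rewrite /koszul_diff wedge_dform big1 // => i iA; rewrite w2 ?mulr0 //.
apply: contra_neq AT => A2; apply/eqP; rewrite eqEcard subsetT cardsT card_ord.
by rewrite (cardsD1 i A) iA A2.
Qed.

Lemma Omega2P e w :
  Omega 2 (e.+2)%:Z w <-> is_2form w /\ forall k, vec w k \is e.-homog.
Proof.
have homog_sign k p : ((-1) ^+ k * p : S) \is e.-homog = (p \is e.-homog).
  by rewrite -signr_odd mulr_sign; case: odd; rewrite ?rpredN.
split=> [Ow | [w2 w_hom] A m mw].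
  split=> [A | k].
    move=> A2; apply/eqP; apply: contraNT A2 => wA.
    by have [->] := Ow A _ (mlead_supp wA).
  rewrite /vec homog_sign; apply/dhomogP => m /Ow[_ /eqP].
  by rewrite eqz_nat add2n !eqSS => /eqP.
have A2 : #|A| = 2.
  by apply/eqP; apply: contraT => /w2 wA; rewrite wA msupp0 in mw.
split=> //; have [k Ak] := card2_compl1 A2; have := w_hom k.
by rewrite /vec homog_sign -Ak => /dhomogP/(_ m mw) /= ->.
Qed.

Lemma Omega2_cases q w : Omega 2 q w -> w != 0 -> exists e, q = (e.+2)%:Z.
Proof.
move=> Ow w0; have [A wA] : exists A, w A != 0.
  apply: contra_neqP w0 => no_A; apply/ffunP => A; rewrite ffunE.
  by apply/eqP; apply: contra_notT no_A => wA; exists A.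
by have [_ <-] := Ow A _ (mlead_supp wA); exists (mdeg (mlead (w A))).
Qed.

(** The coefficients of a coboundary are in the ideal of the derivatives of f,
which have degree N - 1. *)
Lemma low_degree_coboundary N f e w : f \is N.-homog -> (e < N.-1)%N ->
  Omega 2 (e.+2)%:Z w -> (exists eta, w = koszul_diff f eta) -> w = 0.
Proof.
move=> f_hom lt_e /Omega2P[w2 w_hom] [eta def_w].
apply: vec_inj => // [A _ | k]; first by rewrite ffunE.
rewrite {2}/vec ffunE mulr0 -(pihomog_dE (w_hom k)) /vec def_w.
rewrite /koszul_diff wedge_dform mulr_sumr raddf_sum big1 // => i _ /=.
rewrite mulrCA [_ * grad f i]mulrC -!mulrA.
by rewrite (pihomogM_lt _ (mderiv_homog i f_hom)).
Qed.

Lemma vecD u v k : vec (u + v) k = vec u k + vec v k.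
Proof. by rewrite /vec ffunE mulrDr. Qed.

Lemma vecN u k : vec (- u) k = - vec u k.
Proof. by rewrite /vec ffunE mulrN. Qed.

Lemma vecZ c u k : vec (c *: u) k = c *: vec u k.
Proof. by rewrite /vec ffunE scalerAr. Qed.

Lemma vec_fscale h u k : vec (fscale h u) k = h * vec u k.
Proof. by rewrite /vec ffunE mulrCA. Qed.

Lemma vec_sum (I : finType) (u : I -> polyform K) k :
  vec (\sum_i u i) k = \sum_i vec (u i) k.
Proof. by rewrite /vec sum_ffunE mulr_sumr. Qed.

Lemma Jac_dot f g h : Jac f g h = dot (grad f) (cross (grad g) (grad h)).
Proof.
rewrite /Jac (expand_det_row _ 0) dotE sum3E /cofactor !det_mx22 !mxE /=.
rewrite !(tnth_nth 0) /= !crossE /grad.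
have l00 : lift (0 : 'I_3) (0 : 'I_2) = 1 by apply: val_inj.
have l01 : lift (0 : 'I_3) (1 : 'I_2) = 2 by apply: val_inj.
have l10 : lift (1 : 'I_3) (0 : 'I_2) = 0 by apply: val_inj.
have l11 : lift (1 : 'I_3) (1 : 'I_2) = 2 by apply: val_inj.
have l20 : lift (2 : 'I_3) (0 : 'I_2) = 0 by apply: val_inj.
have l21 : lift (2 : 'I_3) (1 : 'I_2) = 1 by apply: val_inj.
rewrite l00 l01 l10 l11 l20 l21 -[(0 + 1 %% 3)%N]/1%N -[(0 + _ %% 3)%N]/2%N.
ring.
Qed.

End TwoForms.

(** * The basis of classes gamma_j *)

Section Classes.
Variables (K : fieldType) (f : {mpoly K[3]}).

Lemma koszul_class_sum (I : finType) (c : I -> K) (w : I -> polyform K) :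
  koszul_class f (\sum_i c i *: w i) = \sum_i c i *: koszul_class f (w i).
Proof.
have class0 : koszul_class f 0 = 0 by apply/koszul_class_eq0; exists 0; rewrite linear0.
rewrite (big_morph _ (@koszul_classD K f) class0).
by apply: eq_bigr => i _; symmetry; apply: koszul_scaleE.
Qed.

End Classes.

Section Gammas.
Variable K : fieldType.
Hypotheses (K_closed : alg_closed K) (K_uncountable : uncountable K).
Hypothesis K_char0 : forall n, (n%:R == 0 :> K) = (n == 0%N).
Local Notation S := {mpoly K[3]}.

Variables (N m : nat) (f : S) (fs : 'I_m.+1 -> S) (d : 'I_m.+1 -> nat).
Hypotheses (f_nodal : nodal_curve N f) (fs_irr : forall j, irreducible (fs j)).
Hypotheses (fs_hom : forall j, fs j \is (d j).-homog).
Hypothesis f_prod : f = \prod_j fs j.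

Local Notation l := (@ord_max m).
Local Notation X := (@coord K).

Let N_gt0 : (0 < N)%N. Proof. by case: f_nodal. Qed.
Let f_neq0 : f != 0. Proof. by case: f_nodal. Qed.
Let f_hom : f \is N.-homog. Proof. by case: f_nodal. Qed.

Section OneGamma.
Variable j : 'I_m.+1.
Hypothesis jl : j != l.

Let P : S := \prod_(i | i \notin [:: j; l]) fs i.

Lemma others_pair : others fs j = fs l * P /\ others fs l = fs j * P.
Proof.
rewrite /others /P; split.
  rewrite (bigD1 l) 1?eq_sym //=; congr (_ * _).
  by apply: eq_bigl => i; rewrite !inE negb_or.
rewrite (bigD1 j) //=; congr (_ * _).
by apply: eq_bigl => i; rewrite !inE negb_or andbC.
Qed.

Lemma vec_gamma k : vec (gamma fs N l j) k =
  hcoef fs N l j * 'X_k - P * cross (grad (fs j)) (grad (fs l)) k.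
Proof.
by rewrite vecD vecN !vec_fscale vec_wedge vec_sigma addrC.
Qed.

Lemma gamma_2form : is_2form (gamma fs N l j).
Proof.
have scale2 (h : S) w : is_2form w -> is_2form (fscale h w).
  by move=> w2 A /w2 wA; rewrite ffunE wA mulr0.
move=> A A2; rewrite ffunE [(- fscale _ _) A]ffunE.
rewrite !scale2 ?oppr0 ?addr0 //; [exact: sigma_2form | exact: wedge_2form].
Qed.

(** The residues of gamma_j, that is, of its contraction with the Euler field. *)
Definition gamma_residue i : K :=
  if i == j then (d l)%:R else if i == l then - (d j)%:R else 0.

Lemma gamma_residueE (F : 'I_m.+1 -> S) : \sum_i gamma_residue i *: F i =
  (d l)%:R *: F j - (d j)%:R *: F l.
Proof.
rewrite (bigD1 j) //= (bigD1 l) 1?eq_sym //= big1 ?addr0; last first.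
  by move=> i /andP[/negPf ij /negPf il]; rewrite /gamma_residue ij il scale0r.
by rewrite /gamma_residue eqxx eq_sym (negPf jl) eqxx scaleNr.
Qed.

(** The contraction of sigma is zero, and that of df_j /\ df_l is computed by
Euler's formula for f_j and f_l. *)
Lemma gamma_contraction k :
  cross (vec (gamma fs N l j)) X k = logform fs gamma_residue k.
Proof.
rewrite /logform gamma_residueE; have [-> ->] := others_pair.
pose u := cross (grad (fs j)) (grad (fs l)).
transitivity (- P * cross u X k); first by rewrite /cross !vec_gamma -/u /coord; ring.
rewrite cross_crossl (dot_grad_coord (fs_hom j)) (dot_grad_coord (fs_hom l)).
by rewrite -!scaler_nat -!mul_mpolyC; ring.
Qed.

(** Expand grad f as the sum of the (f / f_i) grad f_i. The terms i = j and
i = l contribute nothing, since df_j /\ df_l occurs in gamma_j; the others add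
up to - N f h_j, whereas df /\ sigma contributes N f h_j. *)
Lemma gamma_cocycle : dot (grad f) (vec (gamma fs N l j)) = 0.
Proof.
pose u := cross (grad (fs j)) (grad (fs l)).
transitivity (hcoef fs N l j * dot (grad f) X - P * dot (grad f) u).
  rewrite /dot !mulr_sumr -sumrB; apply: eq_bigr => k _.
  by rewrite vec_gamma -/u /coord; ring.
have -> : dot (grad f) u = \sum_i others fs i * Jac (fs i) (fs j) (fs l).
  rewrite /dot; under eq_bigr do rewrite (gradE f_prod) mulr_suml.
  rewrite exchange_big; apply: eq_bigr => i _; rewrite Jac_dot /dot mulr_sumr.
  by apply: eq_bigr => k _; rewrite mulrA.
have Jac0 i : (i == j) || (i == l) -> Jac (fs i) (fs j) (fs l) = 0.
  by rewrite Jac_dot dotE !crossE; case/orP => /eqP ->; ring.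
rewrite (dot_grad_coord f_hom) -scaler_nat -scalerAr /hcoef -scalerAl scalerA.
rewrite mulfV ?K_char0 -?lt0n // scale1r mulr_suml mulr_sumr big_mkcond -sumrB.
apply: big1 => i _ /=; case: ifP => [/andP[ij il] | ijl]; last first.
  rewrite Jac0 ?mulr0 ?subr0 //; move: ijl; case: (i == j) => //=.
  by case: (i == l).
have -> : P = fs i * \prod_(i0 | i0 \notin [:: i; j; l]) fs i0.
  rewrite /P (bigD1 i) /=; last by rewrite !inE negb_or ij.
  congr (_ * _); apply: eq_bigl => k; rewrite !inE !negb_or.
  by rewrite andbC.
by rewrite [X in _ * X - _](othersE f_prod i); ring.
Qed.

Lemma degree_ge2 : (1 < N)%N.
Proof.
have oj0 : others fs j != 0.
  by apply: contraNneq f_neq0 => oj0; rewrite (othersE f_prod j) oj0 mulr0.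
have ojNu : others fs j \isn't a GRing.unit.
  apply: contra (fs_nonunit fs_irr l) => ojU.
  by have [oE _] := others_pair; move: ojU; rewrite oE unitrM => /andP[].
have := homog_msize_le f_hom; rewrite (othersE f_prod j) msizeM ?(fs_neq0 fs_irr) //.
have := mpoly_nonunit_msize (fs_neq0 fs_irr j) (fs_nonunit fs_irr j).
have := mpoly_nonunit_msize oj0 ojNu.
case: (msize (others fs j)) => [|[|p]] //; case: (msize (fs j)) => [|[|q]] // _ _.
by rewrite !addSn !addnS /= ltnS; apply: leq_trans.
Qed.

(** The product of N f and gamma_j is the cross product of grad f with the
contraction of gamma_j, which is homogeneous. *)
Lemma gamma_homog k : vec (gamma fs N l j) k \is (N.-2).-homog.
Proof.
have [n def_N] : exists n, N = n.+2.
  by move: degree_ge2; case: (N) => [|[|n]] // _; exists n.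
have gr_hom i : grad f i \is n.+1.-homog.
  by have := mderiv_homog i f_hom; rewrite def_N.
have b_hom i : cross (vec (gamma fs N l j)) X i \is n.+1.-homog.
  by rewrite gamma_contraction; have := logform_homog f_nodal fs_irr fs_hom
    f_prod gamma_residue i; rewrite def_N.
have -> : N.-2 = n by rewrite def_N.
apply: (homog_mul_cancel (g := N%:R *: f) (e := N)).
- by rewrite scaler_eq0 negb_or K_char0 -lt0n N_gt0 f_neq0.
- exact: rpredZ.
rewrite -(syzygy_cross f_nodal gamma_cocycle).
have -> : (N + n = n.+1 + n.+1)%N by rewrite def_N !addSn addnS.
by apply: rpredB; apply: dhomogM.
Qed.

End OneGamma.
End Gammas.

Section Basis.
Variable K : fieldType.
Hypotheses (K_closed : alg_closed K) (K_uncountable : uncountable K).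
Hypothesis K_char0 : forall n, (n%:R == 0 :> K) = (n == 0%N).
Local Notation S := {mpoly K[3]}.

Variables (N m : nat) (f : S) (fs : 'I_m.+1 -> S) (d : 'I_m.+1 -> nat).
Hypotheses (f_nodal : nodal_curve N f) (fs_irr : forall j, irreducible (fs j)).
Hypotheses (fs_hom : forall j, fs j \is (d j).-homog).
Hypothesis f_prod : f = \prod_j fs j.

Local Notation l := (@ord_max m).
Local Notation X := (@coord K).
Local Notation iota j := (widen_ord (leq_pred m.+1) j).

Let f_neq0 : f != 0. Proof. by case: f_nodal. Qed.
Let f_hom : f \is N.-homog. Proof. by case: f_nodal. Qed.

Lemma iota_neq (j : 'I_m.+1.-1) : iota j != l.
Proof. by rewrite -val_eqE /= neq_ltn ltn_ord. Qed.

Lemma sum_iota (V : nmodType) (F : 'I_m.+1 -> V) :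
  \sum_i F i = \sum_(j < m.+1.-1) F (iota j) + F l.
Proof.
rewrite big_ord_recr /=; congr (_ + _); apply: eq_bigr => j _.
by congr F; apply: val_inj.
Qed.

Definition gamma_comb (b : 'I_m.+1.-1 -> K) : polyform K :=
  \sum_j b j *: gamma fs N l (iota j).

Definition comb_residue (b : 'I_m.+1.-1 -> K) (i : 'I_m.+1) : K :=
  \sum_j b j * gamma_residue K d (iota j) i.

Lemma comb_residue_iota b j : comb_residue b (iota j) = b j * (d l)%:R.
Proof.
rewrite /comb_residue (bigD1 j) //= big1 ?addr0 => [|i ij].
  by rewrite /gamma_residue eqxx.
rewrite /gamma_residue (negPf (iota_neq j)) -val_eqE /= eq_sym val_eqE (negPf ij).
by rewrite mulr0.
Qed.

Lemma comb_residue_last b : comb_residue b l = - \sum_j b j * (d (iota j))%:R.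
Proof.
rewrite /comb_residue -sumrN; apply: eq_bigr => j _.
by rewrite /gamma_residue eq_sym (negPf (iota_neq j)) eqxx mulrN.
Qed.

Lemma gamma_comb_contraction b k :
  cross (vec (gamma_comb b)) X k = logform fs (comb_residue b) k.
Proof.
transitivity (\sum_j b j *: cross (vec (gamma fs N l (iota j))) X k).
  rewrite /cross !vec_sum !mulr_suml -sumrB; apply: eq_bigr => j _.
  by rewrite !vecZ -!scalerAl -scalerBr.
under eq_bigr => j _.
  rewrite (gamma_contraction N fs_hom (iota_neq j)) /logform scaler_sumr.
  over.
rewrite exchange_big; apply: eq_bigr => i _ /=.
by rewrite /comb_residue scaler_suml; apply: eq_bigr => j _; rewrite scalerA.
Qed.

Lemma gamma_comb_cocycle b : dot (grad f) (vec (gamma_comb b)) = 0.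
Proof.
transitivity (\sum_j b j *: dot (grad f) (vec (gamma fs N l (iota j)))).
  rewrite /dot; under eq_bigr => k _ do rewrite vec_sum mulr_sumr.
  rewrite exchange_big; apply: eq_bigr => j _; rewrite scaler_sumr.
  by apply: eq_bigr => k _; rewrite vecZ -scalerAr.
rewrite big1 // => j _.
by rewrite (gamma_cocycle K_char0 f_nodal f_prod (iota j)) scaler0.
Qed.

Lemma gamma_comb_2form b : is_2form (gamma_comb b).
Proof.
move=> A A2; rewrite /gamma_comb sum_ffunE big1 // => j _.
by rewrite ffunE gamma_2form // scaler0.
Qed.

Lemma gamma_comb_homog b k : vec (gamma_comb b) k \is (N.-2).-homog.
Proof.
rewrite vec_sum; apply: rpred_sum => j _; rewrite vecZ; apply: rpredZ.
exact: (gamma_homog K_char0 f_nodal fs_irr fs_hom f_prod (iota_neq j)).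
Qed.

Lemma gamma_H j : koszul_H (f := f) 2 N%:Z (koszul_class f (gamma fs N l (iota j))).
Proof.
have N2 := degree_ge2 f_nodal fs_irr f_prod (iota_neq j).
exists (gamma fs N l (iota j)); split=> //.
  have eN : N%:Z = (N.-2.+2)%:Z by move: N2; case: (N) => [|[]].
  rewrite [N%:Z]eN; apply/Omega2P; split; first exact: gamma_2form.
  exact: (gamma_homog K_char0 f_nodal fs_irr fs_hom f_prod (iota_neq j)).
apply/koszul_diff2; first exact: gamma_2form.
exact: (gamma_cocycle K_char0 f_nodal f_prod (iota j)).
Qed.

(** The residues of the sum of the b_j gamma_j are b_j d_l for j <> l, and
- sum_j b_j d_j for l. So they determine b, and they are arbitrary constants
c_i subject to sum_i c_i d_i = 0, a relation that the residues of any syzygy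
satisfy. *)
Lemma gamma_basis : is_basis (koszul_H (f := f) 2 N%:Z)
  (fun j => koszul_class f (gamma fs N l (iota j))).
Proof.
split; first exact: gamma_H.
  move=> b; rewrite -koszul_class_sum -/(gamma_comb b) => /koszul_class_eq0 cob j.
  have N2 := degree_ge2 f_nodal fs_irr f_prod (iota_neq j).
  have comb0 : gamma_comb b = 0.
    apply: (low_degree_coboundary f_hom (e := N.-2)) cob.
      by move: N2; case: (N) => [|[]].
    by apply/Omega2P; split; [apply: gamma_comb_2form | apply: gamma_comb_homog].
  have log0 k : logform fs (comb_residue b) k = 0.
    by rewrite -gamma_comb_contraction comb0 /cross /vec !ffunE !mulr0 !mul0r subrr.
  have /eqP := logform_inj K_char0 f_nodal fs_irr fs_hom f_prod log0 (iota j).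
  rewrite comb_residue_iota mulf_eq0 (negPf (degree_neq0 K_char0 fs_irr fs_hom l)).
  by rewrite orbF => /eqP.
move=> _ [w [Ow w_cocycle ->]].
have [-> | w0] := eqVneq w 0.
  exists (fun _ => 0); rewrite big1 => [|j _]; last by rewrite scale0r.
  by apply/koszul_class_eq0; exists 0; rewrite linear0.
have [e [eN]] := Omega2_cases Ow w0.
rewrite eN in Ow; have [w2 w_hom] := (Omega2P e w).1 Ow.
have w_syz := (koszul_diff2 f w2).1 w_cocycle.
have [c cP] := beta_logform K_closed K_uncountable K_char0 f_nodal fs_irr fs_hom
  f_prod w_hom w_syz (esym eN).
have dl0 := degree_neq0 K_char0 fs_irr fs_hom l.
(* Contract beta = logform fs c with X once more. *)
have sum_c : \sum_i c i * (d i)%:R = 0.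
  apply/eqP; have : dot (logform fs c) X = 0.
    by rewrite dotE -!cP !crossE; ring.
  rewrite (dot_logform fs_hom f_prod) => /eqP.
  by rewrite scaler_eq0 (negPf f_neq0) orbF.
pose b j := c (iota j) / (d l)%:R.
have res_b i : comb_residue b i = c i.
  have [il | il] := eqVneq i l; last first.
    have lt_i : (i < m.+1.-1)%N.
      by rewrite /= ltn_neqAle -ltnS ltn_ord andbT -val_eqE in il *.
    have -> : i = iota (Ordinal lt_i) by apply: val_inj.
    by rewrite comb_residue_iota divfK.
  rewrite il comb_residue_last; apply: (mulIf dl0); apply/eqP.
  rewrite mulNr eq_sym -addr_eq0 addrC; apply/eqP; rewrite -[RHS]sum_c sum_iota.
  congr (_ + _); rewrite mulr_suml; apply: eq_bigr => j _.
  by rewrite mulrAC divfK.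
exists b; rewrite -koszul_class_sum -/(gamma_comb b); congr koszul_class.
apply: (vec_inj w2) => [|k]; first exact: gamma_comb_2form.
apply/eqP; rewrite -subr_eq0; apply/eqP.
pose a k := vec w k - vec (gamma_comb b) k.
apply: (@syzygy_eq0 _ K_char0 _ _ f_nodal a) => [|i].
  transitivity (dot (grad f) (vec w) - dot (grad f) (vec (gamma_comb b))).
    by rewrite /dot -sumrB; apply: eq_bigr => i _; rewrite mulrBr.
  by rewrite w_syz gamma_comb_cocycle subrr.
transitivity (cross (vec w) X i - cross (vec (gamma_comb b)) X i).
  by rewrite /cross /a; ring.
rewrite cP gamma_comb_contraction /logform -sumrB big1 // => j _.
by rewrite res_b subrr.
Qed.

Lemma low_degree_vanishing (q : int) (c : koszul_quot f) :
  (q < N%:Z)%R -> koszul_H 2 q c -> c = 0.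
Proof.
move=> lt_q [w [Ow w_cocycle ->]]; suff -> : w = 0.
  by apply/koszul_class_eq0; exists 0; rewrite linear0.
have [// | w0] := eqVneq w 0; have [e qe] := Omega2_cases Ow w0.
move: Ow lt_q; rewrite qe ltz_nat => /Omega2P[w2 w_hom] lt_e.
apply: vec_inj => // [A _ | k]; first by rewrite ffunE.
rewrite (low_degree_syzygy K_closed K_uncountable K_char0 f_nodal fs_irr fs_hom f_prod
  lt_e w_hom) ?(koszul_diff2 f w2).1 //.
by rewrite /vec ffunE mulr0.
Qed.

End Basis.

(** * The complex numbers *)

Section Uncountable.
Import classical_sets.
Local Open Scope classical_set_scope.
Variable R : realType.

Lemma avoiding_interval (s : seq R) (a b : R) : a < b ->
  exists p : R * R, [/\ a <= p.1, p.1 < p.2, p.2 <= b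
    & forall x, x \in s -> ~~ (p.1 <= x <= p.2)].
Proof.
elim: s a b => [|y s IHs] a b ab; first by exists (a, b); split=> //=.
have [c [e [ac ce eb yN]]] : exists c e, [/\ a <= c, c < e, e <= b & ~~ (c <= y <= e)].
  have [ym | my] := ltP y ((a + b) / 2).
    by exists ((a + b) / 2), b; split=> //; [lra | lra | rewrite negb_and -ltNge ym].
  exists a, ((3 * a + b) / 4); split=> //; [lra | lra |].
  by rewrite negb_and -!ltNge; apply/orP; right; lra.
have [p [cp pp pe ps]] := IHs c e ce; exists p; split=> //.
- exact: le_trans cp.
- exact: le_trans eb.
move=> x; rewrite inE => /predU1P[-> | /ps //].
apply: contra yN => /andP[py yp]; rewrite (le_trans cp) //=.
exact: le_trans pe.
Qed.

(** Nested intervals, the n-th step avoiding the n-th finite set. *)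
Lemma real_uncountable : uncountable R.
Proof.
move=> F.
have ex_next (np : nat * (R * R)) : exists p : R * R, np.2.1 < np.2.2 ->
    [/\ np.2.1 <= p.1, p.1 < p.2, p.2 <= np.2.2
      & forall x, x \in F np.1 -> ~~ (p.1 <= x <= p.2)].
  have [lt_p | _] := ltP np.2.1 np.2.2; last by exists (0, 0).
  by have [p pP] := avoiding_interval (F np.1) lt_p; exists p.
have [T TP] := choice ex_next.
pose J := fix J n := if n is k.+1 then T (k, J k) else (0, 1).
have J_lt n : (J n).1 < (J n).2.
  elim: n => [|n IHn] /=; first exact: ltr01.
  by have [] := TP (n, J n) IHn.
have JS n := TP (n, J n) (J_lt n).
have J_mono n k : (J n).1 <= (J (n + k)%N).1 /\ (J (n + k)%N).2 <= (J n).2.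
  elim: k => [|k [IH1 IH2]]; first by rewrite addn0.
  rewrite addnS; have [le1 _ le2 _] := JS (n + k)%N.
  by split; [apply: le_trans IH1 le1 | apply: le_trans le2 IH2].
have J_cross n k : (J n).1 <= (J k).2.
  have [le1 _] := J_mono n k; have [_ le2] := J_mono k n.
  by rewrite addnC in le2; apply: le_trans le1 (le_trans (ltW (J_lt _)) le2).
pose E : set R := [set x | exists n, x = (J n).1].
have E_ub k : ubound E (J k).2 by move=> _ [n ->].
exists (sup E) => n; apply/negP => supF.
have le_sup : (J n.+1).1 <= sup E.
  by apply: ub_le_sup; [exists (J 0%N).2 | exists n.+1].
have sup_le : sup E <= (J n.+1).2.
  by apply: ge_sup => //; exists (J 0%N).1; exists 0%N.
by have [_ _ _ /(_ _ supF)] := JS n; rewrite le_sup sup_le.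
Qed.

Lemma complex_uncountable : uncountable (complex R : fieldType).
Proof.
move=> F; have [x xF] := real_uncountable (fun n => map (@complex.Re R) (F n)).
exists (complex.Complex x 0) => n; apply: contra (xF n) => xFn.
by apply/mapP; exists (complex.Complex x 0).
Qed.

Lemma complex_alg_closed : alg_closed (complex R : fieldType).
Proof. by move=> p p1; apply/closed_rootP. Qed.

Lemma complex_char0 n : (n%:R == 0 :> (complex R : fieldType)) = (n == 0%N).
Proof. exact: (@pnatr_eq0 (complex R)). Qed.

End Uncountable.

(* The index l is that of the last component. *)
Theorem theorem4p1 (R : realType) (N r : nat)
    (f : {mpoly (complex R)[3]}) (fs : 'I_r -> {mpoly (complex R)[3]})
    (l : 'I_r) (hl : l.+1 = r :> nat)
    (hf : nodal_curve N f)
    (hirr : forall j, irreducible (fs j))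
    (hhom : forall j, exists d : nat, fs j \is d.-homog)
    (hprod : f = \prod_(j < r) fs j) :
  [/\ forall (q : int) (c : koszul_quot f),
        (q < N%:Z)%R -> koszul_H 2 q c -> c = 0,
      has_dim (koszul_H (f := f) 2 N%:Z) r.-1
    & is_basis (koszul_H (f := f) 2 N%:Z)
        (fun j : 'I_r.-1 =>
           koszul_class f (gamma fs N l (widen_ord (leq_pred r) j)))].
Proof.
case: r l fs hl hirr hhom hprod => [[]//|m] l fs hl hirr hhom hprod.
have -> : l = ord_max by apply: val_inj; case: hl.
have [d hd] := choice hhom.
have basis := gamma_basis (@complex_alg_closed R) (@complex_uncountable R)
  (@complex_char0 R) hf hirr hd hprod.
split=> //; last by eexists; exact: basis.
exact: (low_degree_vanishing (@complex_alg_closed R) (@complex_uncountable R)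
  (@complex_char0 R) hf hirr hd hprod).
Qed.
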